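(* Let $d \ge 1$ be an integer, let $A, B > 0$ and $\alpha, \beta > 0$ be constants, and put $f(n) = A(\log n)^{-\alpha}$ and $c(n) = B(\log n)^{\beta}$ for integers $n \ge 2$. (1) Suppose $\alpha + \beta/2 \le 1$. Then for every integer $k \ge 2$, every sequence $(p_n)_{n \ge k}$ where each $p_n$ is a probability measure on $[n]$ with $$\frac{f(n)}{n} \le p_n(j) \le \frac{c(n)}{n} \quad \text{for all } j \in [n] \text{ and all } n \ge k,$$ and every initialization $a_1, \dots, a_k \in \mathbb{R}^d$, the sequence $(a_n)_{n\ge 1}$ defined by $$a_{n+1} = \sum_{j=1}^n p_n(j)\, a_j \quad \text{for all } n \ge k$$ converges. (2) Suppose $\alpha + \beta/2 > 1$. Then there exist an integer $k \ge 2$, a sequence $(p_n)_{n\ge k}$ of probability measures, $p_n$ on $[n]$, with $\frac{f(n)}{n} \le p_n(j) \le \frac{c(n)}{n}$ for all $j \in [n]$ and all $n \ge k$, and an initialization $a_1, \dots, a_k \in \mathbb{R}^d$, such that the sequence defined by $a_{n+1} = \sum_{j=1}^n p_n(j)\, a_j$ for $n \ge k$ does not converge.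
   Context: $[n] = \{1, \dots, n\}$, and $\log$ is the natural logarithm. *)

(* Defs.v *)
From HB Require Import structures.
From mathcomp Require Import all_boot all_order all_algebra.
From mathcomp Require Import all_classical all_reals all_analysis.

Set Implicit Arguments.
Unset Strict Implicit.
Unset Printing Implicit Defensive.

Import Order.TTheory GRing.Theory Num.Theory.
Import numFieldNormedType.Exports.

Local Open Scope ring_scope.
Local Open Scope classical_set_scope.

Definition f_low (R : realType) (A alpha : R) (n : nat) : R :=
  A * (ln n%:R) `^ (- alpha).

Definition c_up (R : realType) (B beta : R) (n : nat) : R :=
  B * (ln n%:R) `^ beta.

(** A probability measure on [n] = {1, ..., n}, given by its masses [p j];
    the values of [p] outside {1, ..., n} are irrelevant. *)
Definition is_prob_on (R : realType) (n : nat) (p : nat -> R) : Prop :=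
  (forall j : nat, (1 <= j <= n)%N -> 0 <= p j) /\
  \sum_(1 <= j < n.+1) p j = 1.

(** Only the [p n] with [k <= n] are constrained. *)
Definition admissible (R : realType) (f c : nat -> R) (k : nat)
    (p : nat -> nat -> R) : Prop :=
  forall n : nat, (k <= n)%N ->
    is_prob_on n (p n) /\
    (forall j : nat, (1 <= j <= n)%N ->
       f n / n%:R <= p n j /\ p n j <= c n / n%:R).

(** The sequence is (a_n)_{n >= 1}, so [a 0] is a dummy value that never enters
    the recurrence. The initialization is [a 1, ..., a k]; it is unconstrained
    and determines [a n] for all [n >= 1]. *)
Definition averaging_sequence (R : realType) (d k : nat)
    (p : nat -> nat -> R) (a : nat -> 'rV[R]_d) : Prop :=
  forall n : nat, (k <= n)%N ->
    a n.+1 = \sum_(1 <= j < n.+1) p n j *: a j.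

(* Main.v *)
Require Import Defs.
From HB Require Import structures.
From mathcomp Require Import all_boot all_order all_algebra.
From mathcomp Require Import all_classical all_reals all_analysis.
From mathcomp Require Import ring lra zify.

Set Implicit Arguments.
Unset Strict Implicit.
Unset Printing Implicit Defensive.

Import Order.TTheory GRing.Theory Num.Theory.
Import numFieldNormedType.Exports.

Local Open Scope ring_scope.
Local Open Scope classical_set_scope.

(** Write t = ln n, so that f = A t^-alpha and c = B t^beta.

    Convergence. It suffices to treat one coordinate x. Suppose that x stays
    in [L, U] from index N on and that U - L >= g. Let W be a large power of
    ln N, and put s = sqrt c. Two cases, according to the means of the first
    m terms for N W <= m < N W^2:
    - if all of them exceed L by g / (4 s), then the uniform part f / n of
      the weights alone lifts each new term to at least L + f g / (8 s)
      [high_mean_lifts];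
    - if one of them, at m, does not, then only a fraction of order 1 / s of
      the first m terms lies near U. At a later n those terms carry weight at
      most c / n each, while the terms near L, which are most of the first m,
      carry at least f / n each. Both contributions scale like m / n, so the
      comparison does not depend on n, and it keeps the later terms below
      U - f g / (8 s) as long as f and c stay comparable [low_mean_caps].
    Half of such a one-sided gain lasts forever: the terms before N retain a
    total weight of at most c N / n, whereas the bound p <= c / n forces each step to average over terms spread over a fraction 1 / c of
    the past [cap_persists]. Hence the range U - L drops by a constant times
    f / s, that is by at least eta / t when alpha + beta / 2 <= 1, each time
    that n is multiplied by W^3 [range_shrinks, drop_parameters]. As ln W is
    of order ln t, such a step increases ln ln t by O(1 / t) only. The drops
    are thus bounded below by the increments of an unbounded function, so the
    range cannot stay above any g > 0 [scalar_range_small].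

    Divergence. Let the index run through consecutive phases whose endpoints
    have ratio rho of order sqrt c, and aim alternately at 0 and at 1. In
    each phase the weight that the lower bound leaves free is spread evenly
    over the second half of [1, 2 h], where 2 h is the end of the phase
    before the previous one; that half aims at the same target, and is a
    fraction of order 1 / rho^2 of the current indices, which is what the
    upper bound c / n allows. The unavoidable uniform part costs f times
    the distance of the running mean to the target, and this distance has
    decayed to order 1 / rho by the second half of the phase
    [phase_deviation]. The errors add up to a sum of f / rho over the
    phases, which is a sum of t^-(alpha + beta / 2) over points t at distance
    at least 1 / 2: it converges, and it is small when the phases start late
    [powR_decrement_ge, scalar_oscillation]. *)

(** * Weighted means under a density bound *)

Definition scalar_averaging (R : realType) (k : nat) (p : nat -> nat -> R)
    (x : nat -> R) : Prop :=
  forall n : nat, (k <= n)%N -> x n.+1 = \sum_(1 <= j < n.+1) p n j * x j.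

Lemma sub_weighted_mean (R : realType) (n : nat) (q x : nat -> R) (b : R) :
  \sum_(1 <= j < n.+1) q j = 1 ->
  b - \sum_(1 <= j < n.+1) q j * x j = \sum_(1 <= j < n.+1) q j * (b - x j).
Proof.
move=> q1; rewrite -[in LHS](mulr1 b) -q1 mulr_sumr -sumrB.
by apply: eq_bigr => j _; rewrite mulrBr mulrC.
Qed.

Lemma sum_below_le (R : realType) (n X : nat) (K : R) : 0 <= K ->
  \sum_(1 <= j < n.+1) (if (j < X)%N then K else 0) <= X%:R * K.
Proof.
move=> K0; suff -> : \sum_(1 <= j < n.+1) (if (j < X)%N then K else 0) =
    (minn n X.-1)%:R * K.
  by apply: ler_wpM2r => //; rewrite ler_nat; lia.
elim: n => [|n IH]; first by rewrite big_geq// min0n mul0r.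
rewrite big_nat_recr//= IH; case: ifP => nX.
  have -> : minn n.+1 X.-1 = (minn n X.-1).+1 by lia.
  by rewrite -(addn1 (minn _ _)) natrD mulrDl mul1r.
by rewrite addr0; congr (_%:R * _); lia.
Qed.

(** At least half of the mass lies at distance at least n / (4 c) from n, because the
    last n / (2 c) indices carry at most c / n each. *)
Lemma mean_distance_ge (R : realType) (n : nat) (q : nat -> R) (c : R) :
  1 <= c -> 4 * c <= n%:R -> is_prob_on n q ->
  (forall j, (1 <= j <= n)%N -> q j <= c / n%:R) ->
  n%:R / (8 * c) <= \sum_(1 <= j < n.+1) q j * (n - j)%:R.
Proof.
move=> c1 cn [q0 q1] qc.
have c0 : 0 < c by lra.
have n0 : 0 < n%:R :> R by lra.
(* the last h indices have total mass at most 1 / 2 *)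
pose h := Num.truncn (n%:R / (2 * c)).
have y0 : 2 <= n%:R / (2 * c) by rewrite ler_pdivlMr; lra.
have /andP[h1 h2] : (h%:R : R) <= n%:R / (2 * c) < h.+1%:R.
  by apply: truncn_itv; lra.
have h2' : n%:R / (4 * c) <= h%:R.
  have E : n%:R / (4 * c) = n%:R / (2 * c) / 2 by field; lra.
  by move: h2 y0; rewrite -natr1 E; set y := n%:R / (2 * c); lra.
have hn : (h <= n)%N.
  rewrite -(ler_nat R); apply: (le_trans h1).
  by rewrite ler_pdivrMr ?ler_peMr//; lra.
have split1 : \sum_(1 <= j < n.+1) q j = \sum_(1 <= j < (n - h).+1) q j +
    \sum_((n - h).+1 <= j < n.+1) q j by rewrite -big_cat_nat//=; lia.
have tail : \sum_((n - h).+1 <= j < n.+1) q j <= 2^-1.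
  apply: (@le_trans _ _ (\sum_((n - h).+1 <= j < n.+1) (c / n%:R))).
    by apply: ler_sum_nat => j jh; apply: qc; lia.
  rewrite sumr_const_nat (_ : (n.+1 - (n - h).+1)%N = h); last by lia.
  rewrite -[_ *+ h]mulr_natl mulrA ler_pdivrMr//.
  by move: h1; rewrite ler_pdivlMr; lra.
rewrite (@big_cat_nat _ _ _ (n - h).+1)//=; last by lia.
apply: (@le_trans _ _ (\sum_(1 <= j < (n - h).+1) q j * h%:R)).
  rewrite -mulr_suml.
  have E : n%:R / (8 * c) = n%:R / (4 * c) / 2 by field; lra.
  rewrite E; nra.
rewrite -[leLHS]addr0; apply: lerD.
  apply: ler_sum_nat => j jh; apply: ler_wpM2l; first by apply: q0; lia.
  by rewrite ler_nat; lia.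
rewrite big_nat; apply: sumr_ge0 => j jh; rewrite mulr_ge0//; apply: q0; lia.
Qed.

(** This is 1 / sqrt (1 - v) >= 1 + v / 2 with v = (n - j) / n. *)
Lemma sqrt_ratio_ge (R : realType) (X j n : nat) : (0 < j <= n)%N ->
  Num.sqrt (X%:R / n%:R) * (1 + (n - j)%:R / (2 * n%:R)) <=
  Num.sqrt (X%:R / j%:R) :> R.
Proof.
move=> /andP[j0 jn].
have j0' : 0 < j%:R :> R by rewrite ltr0n.
have jn' : j%:R <= n%:R :> R by rewrite ler_nat.
have n0' : 0 < n%:R :> R by lra.
have X0 : 0 <= X%:R :> R by [].
set u := _ / (2 * _).
have u0 : 0 <= u by rewrite /u divr_ge0//; lra.
have uE : u * (2 * n%:R) = n%:R - j%:R.
  by rewrite /u divfK ?natrB//; lra.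
have -> : 1 + u = Num.sqrt ((1 + u) ^+ 2) by rewrite sqrtr_sqr ger0_norm//; lra.
rewrite -sqrtrM ?divr_ge0//; apply: ler_wsqrtr.
rewrite ler_pdivlMr//.
have -> : X%:R / n%:R * (1 + u) ^+ 2 * j%:R = X%:R * ((1 + u) ^+ 2 * j%:R / n%:R).
  by field; lra.
rewrite -[leRHS]mulr1; apply: ler_wpM2l => //.
rewrite ler_pdivrMr// mul1r.
have -> : j%:R = n%:R - u * (2 * n%:R) by lra.
have -> : (1 + u) ^+ 2 * (n%:R - u * (2 * n%:R)) =
  n%:R - n%:R * u ^+2 * (3 + 2 * u) by ring.
rewrite gerBl; apply: mulr_ge0; last by lra.
by rewrite mulr_ge0 ?sqr_ge0//; lra.
Qed.

(** * One-sided gains and the drop of the range *)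

(** Terms before X may exceed U by E, and their weight c X / n accumulates over
    infinitely many steps, so a constant bound is not inductive. The bound
    U - delta (1 + sqrt (X / n)) is: by [mean_distance_ge] the slack
    sqrt (X / j) exceeds sqrt (X / n) on average by a fraction 1 / (16 c),
    and this outweighs c X / n as soon as sqrt (X / n) is below
    delta / (36 E c^2). *)
Lemma cap_persists (R : realType) (f c : nat -> R) (k : nat)
    (p : nat -> nat -> R) (x : nat -> R) (X Y : nat) (U E delta : R) :
  admissible f c k p -> scalar_averaging k p x ->
  (1 <= X <= Y)%N -> (k <= Y)%N -> 0 < delta -> 2 * delta <= E ->
  (forall j, (1 <= j)%N -> x j <= U + E) ->
  (forall j, (X <= j <= Y)%N -> x j <= U - 2 * delta) ->
  (forall n, (Y <= n)%N -> [/\ 1 <= c n, 4 * c n <= n%:R &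
     36 * E * c n ^+ 2 * Num.sqrt (X%:R / n%:R) <= delta]) ->
  forall j, (X <= j)%N -> x j <= U - delta.
Proof.
move=> adm avg /andP[X1 XY] kY d0 dE xE xY large.
pose r j : R := Num.sqrt (X%:R / j%:R).
have r0 j : 0 <= r j by exact: sqrtr_ge0.
have r1 j : (X <= j)%N -> r j <= 1.
  move=> Xj; have j0 : 0 < j%:R :> R by rewrite ltr0n; lia.
  by rewrite -(sqrtr1 R); apply: ler_wsqrtr; rewrite ler_pdivrMr ?mul1r ?ler_nat.
suff H n : (X <= n)%N -> 0 <= U - x n - delta * (1 + r n).
  move=> j Xj; have := H j Xj; rewrite mulrDr mulr1.
  have := mulr_ge0 (ltW d0) (r0 j); lra.
elim/ltn_ind: n => -[|n] IH Xn; first lia.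
have [nY|Yn] := leqP n.+1 Y.
  have := xY n.+1; rewrite Xn nY => /(_ isT).
  have := ler_wpM2l (ltW d0) (r1 _ Xn); lra.
have [kn n0 nX] : [/\ (k <= n)%N, (0 < n)%N & (X <= n)%N] by split; lia.
have n0' : 0 < n%:R :> R by rewrite ltr0n.
have [c1 cn cr] := large n Yn.
have [[p0 p1] pb] := adm n kn.
have rS : r n.+1 <= r n.
  apply: ler_wsqrtr; apply: ler_wpM2l => //.
  by rewrite lef_pV2 ?posrE ?ltr0n// ler_nat.
suff : 0 <= U - x n.+1 - delta * (1 + r n).
  have := ler_wpM2l (ltW d0) rS; lra.
rewrite avg// addrAC sub_weighted_mean//.
pose K := c n / n%:R * (9 / 4 * E).
have K0 : 0 <= K by rewrite /K !mulr_ge0 ?invr_ge0//; lra.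
(* the terms before X lose at most K each, all others gain from the slack *)
apply: (@le_trans _ _ (\sum_(1 <= j < n.+1)
   (delta * r n / (2 * n%:R) * (p n j * (n - j)%:R) -
    (if (j < X)%N then K else 0)))); last first.
  apply: ler_sum_nat => j /andP[j1 jn].
  have jn' : (1 <= j <= n)%N by lia.
  have pj0 := p0 j jn'; have [_ pjc] := pb j jn'.
  set u : R := (n - j)%:R / (2 * n%:R).
  have u0 : 0 <= u by rewrite divr_ge0//; lra.
  have u1 : u <= 1 / 2.
    rewrite /u ler_pdivrMr; last by lra.
    have : (n - j)%:R <= n%:R :> R by rewrite ler_nat leq_subr.
    lra.
  have -> : delta * r n / (2 * n%:R) * (p n j * (n - j)%:R) =
    p n j * (delta * (r n * u)) by rewrite /u; field; lra.
  case: ifPn => jX.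
    have dru : delta * (r n * u) <= delta * (1 / 2).
      apply: ler_wpM2l; first lra.
      by have := r1 _ nX; have := r0 n; nra.
    have dr1 := ler_wpM2l (ltW d0) (r1 _ nX).
    have := xE j j1.
    set v := delta * (r n * u) in dru *; set w := delta * r n in dr1 *.
    move=> xj.
    have low : v - 9 / 4 * E <= U - delta * (1 + r n) - x j.
      rewrite mulrDr -/w; lra.
    have := ler_wpM2l pj0 low.
    have := ler_wpM2r (_ : 0 <= 9 / 4 * E) pjc; rewrite -/K => /(_ ltac:(lra)).
    lra.
  rewrite subr0; apply: ler_wpM2l => //.
  rewrite -leqNgt in jX; have := IH j jn jX.
  have := sqrt_ratio_ge R X jn'; rewrite -/(r n) -/(r j) -/u => /(ler_wpM2l (ltW d0)).
  rewrite !mulrDr !mulr1; lra.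
rewrite sumrB -mulr_sumr.
have spread := @mean_distance_ge R n (p n) (c n) c1 cn (conj p0 p1)
  (fun j hj => proj2 (pb j hj)).
have below := @sum_below_le R n X K K0.
have drn : 0 <= delta * r n / (2 * n%:R) by rewrite !mulr_ge0 ?invr_ge0//; lra.
have := ler_wpM2l drn spread.
suff : X%:R * K <= delta * r n / (2 * n%:R) * (n%:R / (8 * c n)) by lra.
have XE : X%:R / n%:R = r n ^+ 2 by rewrite sqr_sqrtr// divr_ge0.
have -> : X%:R * K = (X%:R / n%:R) * (c n * (9 / 4 * E)) by rewrite /K; ring.
have -> : delta * r n / (2 * n%:R) * (n%:R / (8 * c n)) = r n * (delta / (16 * c n)).
  by field; lra.
have -> : X%:R / n%:R * (c n * (9 / 4 * E)) = r n * (r n * (c n * (9 / 4 * E))).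
  by rewrite XE; ring.
apply: ler_wpM2l => //.
rewrite ler_pdivlMr; last by lra.
apply: le_trans cr; rewrite -/(r n); lra.
Qed.

(** Linear lower bound for the contribution of one term at depth y below U and
    height b above L, when its weight q is only known up to [lo, hi]: an
    adversary gives weight hi to the terms with y < delta, and those have
    b >= g / 2, so they are paid for by the mean of b. *)
Lemma weighted_gap_ge (R : realFieldType) (lo hi q delta g b y : R) :
  0 <= lo -> lo <= q -> q <= hi -> 0 <= delta -> 0 < g -> 2 * delta <= g ->
  0 <= b -> 0 <= y -> g - b <= y ->
  lo * (g - b - delta) - hi * delta * (2 / g * b) <= q * (y - delta).
Proof.
move=> lo0 loq qhi d0 g0 dg b0 y0 gby.
have hd0 : 0 <= hi * delta by rewrite mulr_ge0// (le_trans lo0)// (le_trans loq).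
have gb0 : 0 <= 2 / g * b by rewrite !mulr_ge0// invr_ge0 ltW.
have h1 : lo * (g - b - delta) <= lo * (y - delta) by apply: ler_wpM2l => //; lra.
have [yd|yd] := lerP 0 (y - delta).
  have h2 : lo * (y - delta) <= q * (y - delta) by exact: ler_wpM2r.
  have := mulr_ge0 hd0 gb0; lra.
have h2 : lo * (y - delta) <= 0 by rewrite mulr_ge0_le0// ltW.
have h3 : hi * (y - delta) <= q * (y - delta) by rewrite ler_wnM2r// ltW.
have h4 : hi * delta * 1 <= hi * delta * (2 / g * b).
  by apply: ler_wpM2l => //; rewrite mulrAC ler_pdivlMr//; lra.
have h5 : 0 <= hi * y by rewrite mulr_ge0// (le_trans lo0)// (le_trans loq).
lra.
Qed.

(** The case of a mean close to L at time m. Up to m, every term contributes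
    through [weighted_gap_ge] a quantity that is affine in x j - L, so only the
    mean of x - L up to m enters. The factor 1 / n comes out of the sum, which
    is why the bound is uniform in n. *)
Lemma low_mean_caps (R : realType) (f c : nat -> R) (k : nat)
    (p : nat -> nat -> R) (x : nat -> R) (L U g E s f0 : R) (N m M W : nat) :
  admissible f c k p -> scalar_averaging k p x ->
  (1 <= m)%N -> (k <= m)%N -> (N * W <= m)%N ->
  (forall n, (m <= n < M)%N -> f0 <= f n /\ c n <= s ^+ 2) ->
  4 <= s -> 0 < f0 <= 1 -> 0 < g <= E -> g <= U - L ->
  100 * E * s ^+ 3 <= f0 * g * W%:R ->
  (forall j, (1 <= j)%N -> L - E <= x j <= U + E) ->
  (forall j, (N <= j)%N -> L <= x j <= U) ->
  \sum_(1 <= j < m.+1) (x j - L) <= m%:R * (g / (4 * s)) ->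
  forall n, (m <= n < M)%N -> x n.+1 <= U - f0 * g / (8 * s).
Proof.
move=> adm avg m1 km NWm fc s4 /andP[f00 f01] /andP[g0 gE] gUL hW xE xLU low.
pose delta := f0 * g / (8 * s); rewrite -/delta.
have s0 : 0 < s by lra.
have fg0 : 0 < f0 * g by exact: mulr_gt0.
have fgg : f0 * g <= g by rewrite ler_piMl// ltW.
have d0 : 0 < delta by rewrite divr_gt0//; lra.
have dE : 8 * s * delta = f0 * g by rewrite /delta; field; lra.
have d32 : 32 * delta <= f0 * g by rewrite -dE ler_wpM2r//; lra.
(* slope of the bound of [weighted_gap_ge] in b, for hi / lo = s^2 / f0 *)
pose lam := f0 + f0 * s / 4.
have lamE : lam = f0 + 2 * s ^+ 2 * delta / g by rewrite /lam /delta; field; lra.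
have lam0 : 0 <= lam by rewrite addr_ge0// ?mulr_ge0//; lra.
(* K absorbs the deficit of a term before N, where x is only within E *)
pose K := f0 * g + lam * E + s ^+ 2 * (E + delta).
have K0 : 0 <= K.
  by rewrite /K !addr_ge0// mulr_ge0 ?sqr_ge0//; lra.
have m0 : 0 < m%:R :> R by rewrite ltr0n.
have NK : N%:R * K <= m%:R * (f0 * g / 4).
  have K25 : K <= 25 * E * s ^+ 3.
    have a1 : f0 * g + lam * E <= (2 + s / 4) * E.
      rewrite /lam mulrDl.
      have : f0 * E <= E by rewrite ler_piMl//; lra.
      have : f0 * s / 4 * E <= s / 4 * E.
        by apply: ler_wpM2r; [lra|rewrite -mulrA ler_piMl//; lra].
      lra.
    have a2 : s ^+ 2 * (E + delta) <= s ^+ 2 * (2 * E).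
      by apply: ler_wpM2l; [exact: sqr_ge0|lra].
    have a3 : 16 <= s ^+ 2 by rewrite (_ : 16 = 4 ^+ 2) ?ler_sqr ?nnegrE//; lra.
    have a4 : s ^+ 3 = s ^+ 2 * s by rewrite exprSr.
    have a5 : 4 * s ^+ 2 <= s ^+ 3 by rewrite a4 mulrC ler_wpM2l//; lra.
    have a6 : s <= s ^+ 2 by rewrite expr2 ler_peMr//; lra.
    have : (2 + s / 4 + 2 * s ^+ 2) * E <= 25 * s ^+ 3 * E.
      by apply: ler_wpM2r; lra.
    rewrite /K; lra.
  apply: (@le_trans _ _ (N%:R * (f0 * g * W%:R / 4))).
    by apply: ler_wpM2l => //; lra.
  have -> : N%:R * (f0 * g * W%:R / 4) = (N * W)%:R * (f0 * g / 4).
    by rewrite natrM; field.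
  by apply: ler_wpM2r; [lra|rewrite ler_nat].
(* n times the total contribution of the first m terms is nonnegative *)
have main : 0 <= \sum_(1 <= j < m.+1)
    (f0 * (g - delta) - lam * (x j - L) - (if (j < N)%N then K else 0)).
  rewrite sumrB sumrB sumr_const_nat -mulr_sumr subn1 /= -[_ *+ m]mulr_natl.
  have := sum_below_le m N K0.
  have := ler_wpM2l lam0 low.
  have -> : lam * (m%:R * (g / (4 * s))) = m%:R * (f0 * g * (1 / (4 * s) + 1 / 16)).
    by rewrite /lam; field; lra.
  have b1 : f0 * g * (1 / (4 * s) + 1 / 16) <= f0 * g * (1 / 8).
    apply: ler_wpM2l; first exact: ltW.
    suff : 1 / (4 * s) <= 1 / 16 by lra.
    by rewrite ler_pdivrMr; lra.
  have b2 : f0 * delta <= delta by rewrite ler_piMl// ltW.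
  have := ler_wpM2l (ltW m0) b1.
  have : m%:R * (f0 * g * (1 / 8) + f0 * g / 4) <= m%:R * (f0 * (g - delta)).
    by apply: ler_wpM2l; [exact: ltW|rewrite mulrBr; lra].
  rewrite mulrDr; lra.
elim/ltn_ind => n IH /andP[mn nM].
have kn : (k <= n)%N by exact: leq_trans mn.
have [[p0 p1] pb] := adm n kn.
have [f0n cs] : f0 <= f n /\ c n <= s ^+ 2 by apply: fc; rewrite mn.
have n0 : 0 < n%:R :> R by rewrite ltr0n (leq_trans m1).
have ni0 : 0 <= n%:R^-1 :> R by rewrite invr_ge0 ltW.
rewrite -subr_ge0 avg// sub_weighted_mean//.
rewrite (@big_cat_nat _ _ _ m.+1)//=.
apply: addr_ge0; last first.
  rewrite big_nat; apply: sumr_ge0 => j /andP[mj jn].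
  rewrite mulr_ge0//; first by apply: p0; rewrite (leq_trans _ mj).
  case: j mj jn => // j mj; rewrite ltnS => jn.
  have mjM : (m <= j < M)%N by apply/andP; split => //; exact: ltn_trans jn nM.
  by have := IH j jn mjM; lra.
apply: (@le_trans _ _ (n%:R^-1 * \sum_(1 <= j < m.+1)
    (f0 * (g - delta) - lam * (x j - L) - (if (j < N)%N then K else 0)))).
  exact: mulr_ge0.
rewrite mulr_sumr; apply: ler_sum_nat => j /andP[j1 jm].
have jn : (1 <= j <= n)%N by rewrite j1 (leq_trans _ mn).
have pj0 := p0 j jn; have [pf pc] := pb j jn.
have pf' : f0 / n%:R <= p n j by apply: le_trans pf; rewrite ler_wpM2r.
have pc' : p n j <= s ^+ 2 / n%:R by apply: (le_trans pc); rewrite ler_wpM2r.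
have /andP[xl xu] := xE j j1.
case: ifPn => jN.
  have c1 : p n j * - (E + delta) <= p n j * (U - delta - x j).
    by apply: ler_wpM2l => //; lra.
  have c2 : p n j * (E + delta) <= s ^+ 2 / n%:R * (E + delta).
    by apply: ler_wpM2r => //; lra.
  have c3 : n%:R^-1 * (f0 * (g - delta) - lam * (x j - L) - K) <=
            n%:R^-1 * (- (s ^+ 2 * (E + delta))).
    apply: ler_wpM2l => //; rewrite /K.
    have : lam * (L - x j) <= lam * E by apply: ler_wpM2l => //; lra.
    have : 0 <= f0 * delta by rewrite mulr_ge0// ltW.
    lra.
  move: c1 c2 c3; rewrite !mulrN; lra.
have /andP[xl' xu'] : L <= x j <= U by apply: xLU; rewrite leqNgt.
rewrite subr0 lamE.
have -> : n%:R^-1 * (f0 * (g - delta) - (f0 + 2 * s ^+ 2 * delta / g) * (x j - L)) =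
    f0 / n%:R * (g - (x j - L) - delta) -
    s ^+ 2 / n%:R * delta * (2 / g * (x j - L)).
  by field; rewrite !gt_eqF.
rewrite (addrAC U); apply: weighted_gap_ge => //.
- by rewrite divr_ge0// ltW.
- exact: ltW.
- lra.
- by rewrite subr_ge0.
- by rewrite subr_ge0.
- lra.
Qed.

(** The case of a mean far from L: the uniform part f / m suffices, and the
    terms before N are too few to undo its effect. *)
Lemma high_mean_lifts (R : realType) (f c : nat -> R) (k : nat)
    (p : nat -> nat -> R) (x : nat -> R) (L g E s f0 : R) (N m W : nat) :
  admissible f c k p -> scalar_averaging k p x ->
  (1 <= m)%N -> (k <= m)%N -> (N * W <= m)%N ->
  f0 <= f m -> c m <= s ^+ 2 -> 4 <= s -> 0 < f0 -> 0 < g <= E ->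
  100 * E * s ^+ 3 <= f0 * g * W%:R ->
  (forall j, (1 <= j)%N -> L - E <= x j) ->
  (forall j, (N <= j)%N -> L <= x j) ->
  m%:R * (g / (4 * s)) <= \sum_(1 <= j < m.+1) (x j - L) ->
  L + f0 * g / (8 * s) <= x m.+1.
Proof.
move=> adm avg m1 km NWm f0m cs s4 f00 /andP[g0 gE] hW xE xL high.
have s0 : 0 < s by lra.
have fg0 : 0 < f0 * g by exact: mulr_gt0.
have m0 : 0 < m%:R :> R by rewrite ltr0n.
have mi0 : 0 <= m%:R^-1 :> R by rewrite invr_ge0 ltW.
have [[p0 p1] pb] := adm m km.
have sE0 : 0 <= s ^+ 2 * E by rewrite mulr_ge0 ?sqr_ge0//; lra.
have K0 : 0 <= s ^+ 2 / m%:R * E.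
  by rewrite mulrAC mulr_ge0.
suff : f0 * g / (8 * s) <= x m.+1 - L by lra.
rewrite -lerN2 opprB avg// sub_weighted_mean//.
apply: (@le_trans _ _ (- \sum_(1 <= j < m.+1) (f0 / m%:R * (x j - L) -
    (if (j < N)%N then s ^+ 2 / m%:R * E else 0)))).
  rewrite -sumrN; apply: ler_sum_nat => j jm.
  have jm' : (1 <= j <= m)%N by [].
  have pj0 := p0 j jm'; have [pf pc] := pb j jm'.
  have pf' : f0 / m%:R <= p m j by apply: le_trans pf; rewrite ler_wpM2r.
  have pc' : p m j <= s ^+ 2 / m%:R by apply: (le_trans pc); rewrite ler_wpM2r.
  have fm0 : 0 <= f0 / m%:R by rewrite divr_ge0// ltW.
  rewrite -[leLHS]opprK lerN2 -mulrN opprB; case: ifPn => jN.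
    have /andP[j1 _] := jm.
    have := xE j j1; have [y0|y0] := lerP 0 (x j - L) => xE'.
      have : f0 / m%:R * (x j - L) <= p m j * (x j - L) by exact: ler_wpM2r.
      lra.
    have : (p m j - f0 / m%:R) * (L - x j) <= s ^+ 2 / m%:R * E.
      by apply: ler_pM => //; lra.
    rewrite mulrBl; lra.
  rewrite subr0; apply: ler_wpM2r => //; rewrite subr_ge0; apply: xL.
  by rewrite leqNgt.
rewrite lerN2 sumrB -mulr_sumr.
have := sum_below_le m N K0.
have : f0 / m%:R * (m%:R * (g / (4 * s))) <= f0 / m%:R * \sum_(1 <= j < m.+1) (x j - L).
  by apply: ler_wpM2l => //; rewrite divr_ge0// ltW.
have -> : f0 / m%:R * (m%:R * (g / (4 * s))) = f0 * g / (8 * s) * 2 by field; lra.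
suff : N%:R * (s ^+ 2 / m%:R * E) <= f0 * g / (8 * s) by lra.
have -> : N%:R * (s ^+ 2 / m%:R * E) = N%:R * (s ^+ 2 * E) / m%:R by field; lra.
rewrite ler_pdivrMr//.
have NWm' : N%:R * W%:R <= m%:R :> R by rewrite -natrM ler_nat.
apply: (@le_trans _ _ (f0 * g / (8 * s) * (N%:R * W%:R))); last first.
  by apply: ler_wpM2l => //; rewrite divr_ge0//; lra.
have -> : f0 * g / (8 * s) * (N%:R * W%:R) = N%:R * (f0 * g * W%:R / (8 * s)).
  by field; lra.
apply: ler_wpM2l => //; rewrite ler_pdivlMr; last by lra.
have : 0 <= E * s ^+ 3 by rewrite mulr_ge0 ?exprn_ge0//; lra.
have -> : s ^+ 3 = s ^+ 2 * s by rewrite exprSr.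
lra.
Qed.

Lemma scalar_averagingN (R : realType) (k : nat) (p : nat -> nat -> R)
    (x : nat -> R) :
  scalar_averaging k p x -> scalar_averaging k p (fun j => - x j).
Proof.
by move=> avg n kn; rewrite avg// -sumrN; apply: eq_bigr => j _; rewrite mulrN.
Qed.

(** If the mean is close to L somewhere between N W and N W^2, then the upper
    end of the range moves down; otherwise the lower end moves up. The first
    factor W makes the terms before N negligible; the other two leave, in
    either case, a stretch of ratio W on which the gain is already known, as
    [cap_persists] requires. *)
Lemma range_shrinks (R : realType) (f c : nat -> R) (k : nat)
    (p : nat -> nat -> R) (x : nat -> R) (L U g E s f0 : R) (N W : nat) :
  admissible f c k p -> scalar_averaging k p x ->
  (1 <= N)%N -> (k <= N)%N -> (2 <= W)%N ->
  (forall n, (N <= n < N * W ^ 3)%N -> f0 <= f n /\ c n <= s ^+ 2) ->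
  4 <= s -> 0 < f0 <= 1 -> 0 < g <= E -> g <= U - L ->
  100 * E * s ^+ 3 <= f0 * g * W%:R ->
  (forall X n, (N <= X <= N * W ^ 3)%N -> (X * W <= 2 * n)%N ->
    [/\ 1 <= c n, 4 * c n <= n%:R &
     36 * E * c n ^+ 2 * Num.sqrt (X%:R / n%:R) <= f0 * g / (16 * s)]) ->
  (forall j, (1 <= j)%N -> L - E <= x j <= U + E) ->
  (forall j, (N <= j)%N -> L <= x j <= U) ->
  exists L' U', (forall j, (N * W ^ 3 <= j)%N -> L' <= x j <= U') /\
    U' - L' = U - L - f0 * g / (16 * s).
Proof.
move=> adm avg N1 kN W2 fc s4 f0b gb gUL hW spread xE xLU.
have /andP[f00 f01] := f0b; have /andP[g0 gE] := gb.
have s0 : 0 < s by lra.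
have fg0 : 0 < f0 * g by exact: mulr_gt0.
set delta := f0 * g / (16 * s).
have deltaE : f0 * g / (8 * s) = 2 * delta by rewrite /delta; field; lra.
have d0 : 0 < delta by rewrite divr_gt0//; lra.
have dE : 2 * delta <= E.
  have : f0 * g <= g by rewrite ler_piMl// ltW.
  suff : delta <= f0 * g / 2 by lra.
  rewrite /delta ler_pdivrMr; last by lra.
  have : f0 * g * 1 <= f0 * g * s by apply: ler_wpM2l; lra.
  lra.
have N2E : (N * W ^ 2 = N * W * W)%N by rewrite expnS expn1 mulnA.
have N3E : (N * W ^ 3 = N * W ^ 2 * W)%N by rewrite expnSr mulnA.
have NW0 : (0 < N * W)%N by rewrite muln_gt0 N1 ltnW.
have NN1 : (N < N * W)%N by rewrite -[ltnLHS]muln1 ltn_pmul2l.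
have N12 : (N * W < N * W ^ 2)%N by rewrite N2E ltn_Pmulr.
have N23 : (N * W ^ 2 < N * W ^ 3)%N by rewrite N3E ltn_Pmulr// N2E muln_gt0 NW0 ltnW.
have [[m [m1 m2 low]]|nolow] := pselect (exists m, [/\ (N * W <= m)%N,
    (m < N * W ^ 2)%N &
    \sum_(1 <= j < m.+1) (x j - L) <= m%:R * (g / (4 * s))]).
- exists L, (U - delta); split; last by lra.
  have Nm : (N < m)%N by exact: leq_trans NN1 m1.
  have caps : forall n, (m <= n < N * W ^ 3)%N -> x n.+1 <= U - f0 * g / (8 * s).
    apply: (@low_mean_caps _ f c k p x L U g E s f0 N m _ W) => //.
    + exact: leq_ltn_trans Nm.
    + exact: leq_trans (ltnW Nm).
    + move=> n /andP[mn nM]; apply: fc; rewrite nM andbT.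
      exact: leq_trans (ltnW Nm) mn.
  have mM : (m < N * W ^ 3)%N by exact: ltn_trans m2 N23.
  have := @cap_persists _ f c k p x m.+1 (N * W ^ 3)%N U E delta adm avg.
  rewrite mM => /(_ isT) H j Mj; apply/andP; split.
    by have /andP[] := xLU j (leq_trans (ltnW (ltn_trans NN1 (ltn_trans N12 N23))) Mj).
  apply: H => //.
  + exact: leq_trans (leq_trans kN (ltnW Nm)) (ltnW mM).
  + by move=> i /xE/andP[].
  + by case=> // i; rewrite -deltaE; exact: caps.
  + move=> n Mn; apply: spread.
      by rewrite mM (leq_trans (ltnW Nm)).
    rewrite (leq_trans (_ : _ <= N * W ^ 3)%N)//.
      by rewrite N3E leq_mul2r m2 orbT.
    by rewrite (leq_trans Mn)// leq_pmull.
  + exact: leq_trans mM Mj.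
- exists (L + delta), U; split; last by lra.
  have lifts : forall m, (N * W <= m < N * W ^ 2)%N -> L + 2 * delta <= x m.+1.
    move=> m /andP[m1 m2]; have Nm : (N < m)%N by exact: leq_trans NN1 m1.
    have [f0m cm] : f0 <= f m /\ c m <= s ^+ 2.
      by apply: fc; rewrite (ltnW Nm)/= (ltn_trans m2).
    rewrite -deltaE; apply: (@high_mean_lifts _ f c k p x L g E s f0 N m W) => //.
    + exact: leq_ltn_trans Nm.
    + exact: leq_trans (ltnW Nm).
    + by move=> j /xE/andP[].
    + by move=> j /xLU/andP[].
    + apply/ltW; rewrite ltNge; apply/negP => low; apply: nolow.
      by exists m.
  (* the lower end is the upper end for - x *)
  have := @cap_persists _ f c k p (fun j => - x j) (N * W).+1 (N * W ^ 2)%N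
    (- L) E delta adm (scalar_averagingN avg).
  rewrite N12 => /(_ isT) H j Mj; apply/andP; split; last first.
    by have /andP[] := xLU j (leq_trans (ltnW (ltn_trans NN1 (ltn_trans N12 N23))) Mj).
  rewrite -lerN2 opprD; apply: H => //.
  + by rewrite (leq_trans kN)// ltnW// (ltn_trans NN1).
  + by move=> i /xE/andP[? _]; lra.
  + case=> // i /lifts ?; lra.
  + move=> n Mn; apply: spread.
      by rewrite (leq_trans (ltnW NN1))//= (ltn_trans N12).
    apply: (@leq_trans (2 * (N * W ^ 2))%N); last by rewrite leq_pmul2l.
    by rewrite N2E mulSn mul2n -addnn leq_add2r leq_pmull.
  + by rewrite (leq_trans N12)// (leq_trans (ltnW N23)).
Qed.

(** * Polylogarithmic growth *)

Lemma ln_le_sub1 (R : realType) (y : R) : 0 < y -> ln y <= y - 1.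
Proof.
by move=> y0; rewrite -{1}(subrKC 1 y); apply: le_ln1Dx; lra.
Qed.

Lemma powR_dominates (R : realType) (C a b : R) : a < b ->
  \forall t \near +oo, C * t `^ a <= t `^ b.
Proof.
move=> ab; near=> t.
have t0 : 0 < t by near: t; exact: nbhs_pinfty_gt.
have ba : 0 < b - a by rewrite subr_gt0.
have CE : C <= t `^ (b - a).
  apply: (@le_trans _ _ (`|C| + 1)); first by rewrite (le_trans (ler_norm _))// lerDl.
  rewrite -[leLHS](@powRr1 _ (`|C| + 1)) ?addr_ge0// -(mulVf (lt0r_neq0 ba)) powRrM.
  have tC : (`|C| + 1) `^ (b - a)^-1 <= t by near: t; exact: nbhs_pinfty_ge.
  by apply: ge0_ler_powR; rewrite ?nnegrE ?powR_ge0 ?(ltW ba) ?(ltW t0).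
rewrite -[b](subrK a) powRD; last by rewrite (lt0r_neq0 t0) implybT.
by rewrite ler_wpM2r ?powR_ge0.
Unshelve. all: by end_near. Qed.

Lemma id_dominates_ln (R : realType) (C : R) :
  \forall t \near +oo, C * ln t <= t.
Proof.
have half1 : 2^-1 < 1 :> R by rewrite invf_lt1// ltr1n.
near=> t.
have t1 : 1 < t by near: t; exact: nbhs_pinfty_gt.
have t0 : 0 < t by lra.
have dom : 2 * `|C| * t `^ 2^-1 <= t `^ 1 by near: t; exact: powR_dominates.
rewrite (powRr1 (ltW t0)) in dom; apply: le_trans dom.
have lnt : ln t <= 2 * t `^ 2^-1.
  have -> : ln t = 2 * ln (t `^ 2^-1) by rewrite ln_powR; field.
  rewrite ler_pM2l//; have := ln_le_sub1 (powR_gt0 2^-1 t0); lra.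
have ln0 : 0 <= ln t by rewrite ln_ge0// ltW.
apply: (@le_trans _ _ (`|C| * ln t)); first by rewrite ler_wpM2r// ler_norm.
by rewrite -mulrA mulrCA ler_wpM2l.
Unshelve. all: by end_near. Qed.

Lemma near_ln (R : realType) (P : R -> Prop) :
  (\forall t \near +oo, P t) ->
  exists N0 : nat, forall n, (N0 <= n)%N -> P (ln n%:R).
Proof.
case=> M [_ MP]; exists (Num.truncn (expR M)).+1 => n Mn; apply: MP.
have eM : expR M < n%:R.
  have /andP[_] := truncn_itv (ltW (expR_gt0 M)).
  by move=> /lt_le_trans; apply; rewrite ler_nat.
have n0 : 0 < n%:R :> R := lt_trans (expR_gt0 M) eM.
by rewrite -[ltLHS]expRK ltr_ln// posrE expR_gt0.
Qed.

Lemma powR_homo (R : realType) (r a b : R) :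
  0 <= r -> 0 <= a -> a <= b -> a `^ r <= b `^ r.
Proof.
by move=> r0 a0 ab; apply: ge0_ler_powR => //; rewrite nnegrE ?(le_trans a0).
Qed.

Lemma sqrtr_expR (R : realType) (y : R) : Num.sqrt (expR y) = expR (y / 2).
Proof.
have -> : expR y = expR (y / 2) ^+ 2 by rewrite expr2 -expRD; congr expR; field.
by rewrite sqrtr_sqr ger0_norm// expR_ge0.
Qed.

(** Beyond X, the growth of c^2 is absorbed by the fourth root of n / X, since
    ln n <= ln X * exp (ln (n / X) / ln X). *)
Lemma polylog_dilution (R : realType) (b : R) (X n : nat) :
  0 < b -> (2 <= X <= n)%N -> 8 * b <= ln X%:R ->
  (ln n%:R `^ b) ^+ 2 * Num.sqrt (X%:R / n%:R) <=
  (ln X%:R `^ b) ^+ 2 * Num.sqrt (Num.sqrt (X%:R / n%:R)).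
Proof.
move=> b0 /andP[X2 Xn] bX.
have X0 : 0 < X%:R :> R by rewrite ltr0n ltnW.
have n0 : 0 < n%:R :> R by rewrite ltr0n (leq_trans _ Xn)// ltnW.
set tau := ln X%:R in bX *; set t := ln n%:R.
have tau0 : 0 < tau by lra.
pose d := t - tau.
have d0 : 0 <= d by rewrite subr_ge0 ler_ln ?posrE// ler_nat.
have -> : X%:R / n%:R = expR (- d).
  by rewrite /d opprB expRB !lnK ?posrE.
rewrite !sqrtr_expR.
have tb : t `^ b <= tau `^ b * expR (d / 8).
  have td : t <= tau * expR (d / tau).
    have := ler_wpM2l (ltW tau0) (expR_ge1Dx (d / tau)).
    by rewrite mulrDr mulr1 mulrCA divff ?gt_eqF// mulr1 /d addrC subrK.
  apply: (@le_trans _ _ ((tau * expR (d / tau)) `^ b)).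
    by apply: powR_homo td; [exact: ltW|rewrite /d in d0; lra].
  rewrite powRM ?expR_ge0 ?(ltW tau0)//; apply: ler_wpM2l; first exact: powR_ge0.
  rewrite -expRM ler_expR -mulrA ler_wpM2l// mulrC ler_pdivrMr//; lra.
apply: (@le_trans _ _ ((tau `^ b * expR (d / 8)) ^+ 2 * expR (- d / 2))).
  rewrite ler_wpM2r ?expR_ge0//.
  by rewrite ler_sqr ?nnegrE ?mulr_ge0 ?powR_ge0 ?expR_ge0.
rewrite exprMn -[leLHS]mulrA; apply: ler_wpM2l; first exact: sqr_ge0.
rewrite expr2 -!expRD ler_expR; lra.
Qed.

(** Parameters for one application of [range_shrinks]. As ln (N W^3) <= 2 t for
    t = ln N, the values of f and c at ln n = 2 t serve as f0 and s^2. All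
    requirements on W amount to W >= 2 Z^4 for a quantity Z of order
    t^(5 beta / 2 + alpha), so that W can be taken close to t^kap. *)
Lemma drop_parameters (R : realType) (A B alpha beta E g : R) :
  0 < A -> 0 < B -> 0 < alpha -> 0 < beta -> alpha + beta / 2 <= 1 ->
  0 < g <= E ->
  exists (eta K : R) (N0 : nat), [/\ 0 < eta, 0 < K &
    forall N, (N0 <= N)%N -> 1 < ln N%:R :> R /\
    exists (W : nat) (s f0 : R), [/\ (2 <= W)%N,
      forall n, (N <= n < N * W ^ 3)%N ->
        f0 <= f_low A alpha n /\ c_up B beta n <= s ^+ 2,
      [/\ 4 <= s, 0 < f0 <= 1 & 100 * E * s ^+ 3 <= f0 * g * W%:R],
      forall X n, (N <= X <= N * W ^ 3)%N -> (X * W <= 2 * n)%N ->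
        [/\ 1 <= c_up B beta n, 4 * c_up B beta n <= n%:R &
          36 * E * c_up B beta n ^+ 2 * Num.sqrt (X%:R / n%:R) <=
          f0 * g / (16 * s)] &
      eta / ln N%:R <= f0 * g / (16 * s) /\ ln W%:R <= K * ln (ln N%:R)]].
Proof.
move=> A0 B0 al0 be0 ab1 /andP[g0 gE].
have succ_le_sqr (w y : R) : w <= y -> 2 <= y -> w + 1 <= y ^+ 2.
  by rewrite expr2; nra.
pose b := Num.sqrt B; have b0 : 0 < b by rewrite sqrtr_gt0.
have bB : b ^+ 2 = B by rewrite sqr_sqrtr// ltW.
pose gam := 5%:R * (beta / 2) + alpha.
have gam0 : 0 < gam by rewrite /gam; lra.
pose C0 := 576 * E * b ^+ 5 / (A * g).
have E0 : 0 < E := lt_le_trans g0 gE.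
have C00 : 0 < C0.
  have c576 : 0 < 576 :> R by rewrite ltr0n.
  exact: divr_gt0 (mulr_gt0 (mulr_gt0 c576 E0) (exprn_gt0 5 b0)) (mulr_gt0 A0 g0).
pose kap := gam * 4%:R + 1.
have kap1 : 1 <= kap by rewrite /kap; lra.
have beta20 : 0 < beta / 2 by lra.
pose large (t : R) := [/\ 2 < t, 8 * beta <= t, 6 * kap * ln t <= t &
        4 / b * t `^ 0 <= t `^ (beta / 2)] /\
    [/\ A * t `^ (- alpha) <= t `^ 0,
        2 * C0 ^+ 4 * 2 `^ (gam * 4%:R) * t `^ (gam * 4%:R) <= t `^ kap,
        B^-1 * t `^ 0 <= t `^ beta,
        4 * B * t `^ beta <= t `^ (beta + 1) &
        (beta + 1) * ln t <= t].
have [N0 N0P] : exists N0 : nat, forall N, (N0 <= N)%N -> large (ln N%:R).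
  apply: near_ln; near=> t; split; split; near: t.
  - exact: nbhs_pinfty_gt.
  - by apply: nbhs_pinfty_ge; exact: num_real.
  - exact: id_dominates_ln.
  - exact: powR_dominates.
  - by apply: powR_dominates; rewrite oppr_lt0.
  - by apply: powR_dominates; rewrite /kap; lra.
  - exact: powR_dominates.
  - by apply: powR_dominates; lra.
  - exact: id_dominates_ln.
clearbody kap; exists (A * g / (32 * b)), (2 * kap), N0; split => [| |N NN0].
- by rewrite divr_gt0 ?mulr_gt0.
- by lra.
have {}N0P n : (N <= n)%N -> large (ln n%:R).
  by move=> Nn; apply: N0P; exact: leq_trans Nn.
have [[t2 t8 tln ts] [tf tZ _ _ _]] := N0P N (leqnn N).
set t := ln N%:R in t2 t8 tln ts tf tZ *.
have t1 : 1 < t by rewrite (lt_trans _ t2)// ltr1n.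
split=> //; have t0 : 0 < t := lt_trans ltr01 t1.
rewrite powRr0 mulr1 in ts; rewrite powRr0 in tf.
have N1 : (1 < N)%N.
  rewrite ltnNge; apply/negP => N1; have : t <= 0 by apply: ln_le0; rewrite lern1.
  lra.
have Np : 0 < N%:R :> R by rewrite ltr0n ltnW.
pose u := 2 * t; have u0 : 0 < u by rewrite mulr_gt0// ltr0n.
have tu : t <= u by rewrite /u ler_peMl ?(ltW t0)// ler1n.
pose s := b * u `^ (beta / 2); pose f0 := A * u `^ (- alpha).
have s20 : u `^ (beta / 2) > 0 by exact: powR_gt0.
have sE : s ^+ 2 = B * u `^ beta.
  rewrite /s exprMn bB -powR_mulrn ?powR_ge0// -powRrM.
  by congr (_ * _ `^ _); field.
have f00 : 0 < f0 by rewrite mulr_gt0// powR_gt0.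
(* Z is the ratio of 36 E c^2 to the drop of the range *)
pose Z := C0 * u `^ gam.
have ZE : 36 * E * s ^+ 4 * (16 * s / (f0 * g)) = Z.
  have -> : Z = C0 * ((u `^ (beta / 2)) ^+ 5 * u `^ alpha).
    rewrite /Z /gam powRD; last by rewrite (gt_eqF u0) implybT.
    have -> : u `^ (5%:R * (beta / 2)) = (u `^ (beta / 2)) ^+ 5.
      by rewrite -[RHS]powR_mulrn ?powR_ge0// -powRrM [in RHS]mulrC.
    by [].
  have ua0 : 0 < u `^ alpha by exact: powR_gt0.
  rewrite /f0 /s /C0 powRN; field.
  by rewrite !gt_eqF.
have s4 : 4 <= s.
  apply: (@le_trans _ _ (b * t `^ (beta / 2))).
    by rewrite mulrC -ler_pdivrMr.
  by rewrite ler_pM2l//; apply: powR_homo => //; exact: ltW.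
have f01 : f0 <= 1.
  apply: le_trans tf; rewrite /f0 ler_pM2l// !powRN lef_pV2 ?posrE ?powR_gt0//.
  by apply: powR_homo => //; exact: ltW.
have s0 : 0 < s by rewrite (lt_le_trans _ s4)// ltr0n.
have s1 : 1 <= s by rewrite (le_trans _ s4)// ler1n.
have Z0 : 0 < Z by rewrite mulr_gt0// powR_gt0.
have tk2 : 2 <= t `^ kap.
  apply: (@le_trans _ _ (t `^ 1)); first by rewrite (powRr1 (ltW t0)) ltW.
  exact: ler_powR (ltW t1) _ _ kap1.
pose W := (Num.truncn (t `^ kap)).+1.
have /andP[W1 W2] : (Num.truncn (t `^ kap))%:R <= t `^ kap < W%:R.
  by apply: truncn_itv; exact: powR_ge0.
have Wle : W%:R <= t `^ (2 * kap).
  rewrite mulrC powRrM [leRHS]powR_mulrn ?powR_ge0// /W -natr1.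
  exact: succ_le_sqr.
have W0 : 0 < W%:R :> R by rewrite ltr0n.
have Wn : (2 <= W)%N.
  by rewrite -(ltr_nat R) (le_lt_trans _ W2)// (le_trans _ tk2)// ler1n.
have ZW : 2 * Z ^+ 4 <= W%:R.
  apply: ltW; apply: le_lt_trans W2; apply: le_trans tZ.
  rewrite /Z exprMn -[(u `^ gam) ^+ 4]powR_mulrn ?powR_ge0// -powRrM /u powRM//; last exact: ltW.
  by rewrite !mulrA.
have lnW : ln W%:R <= 2 * kap * ln t.
  by rewrite -ln_powR ler_ln ?posrE// powR_gt0.
have lnNW : ln (N * W ^ 3)%:R <= u.
  rewrite natrM natrX lnM ?posrE ?exprn_gt0// lnXn// -/t -[ln _ *+ 3]mulr_natl /u.
  have W3 : 3 * ln W%:R <= 3 * (2 * kap * ln t) by rewrite ler_pM2l.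
  have E6 : 3 * (2 * kap * ln t) = 6 * kap * ln t by ring.
  rewrite E6 in W3; have -> : 2 * t = t + t by ring.
  by rewrite lerD2l; exact: le_trans W3 tln.
have lnu n : (N <= n)%N -> (n <= N * W ^ 3)%N -> t <= ln n%:R <= u.
  move=> Nn nM; have n0 : 0 < n%:R :> R by rewrite ltr0n (leq_trans _ Nn)// ltnW.
  rewrite ler_ln ?posrE// ler_nat Nn/=; apply: le_trans lnNW.
  by rewrite ler_ln ?posrE// ?ler_nat// ltr0n (leq_trans _ nM)// (leq_trans _ Nn)// ltnW.
exists W, s, f0; split => //.
- move=> n /andP[Nn nM]; have /andP[tn nu] := lnu n Nn (ltnW nM).
  have n0 : 0 < ln n%:R :> R := lt_le_trans t0 tn.
  rewrite /f_low /c_up sE !ler_pM2l// !powRN lef_pV2 ?posrE ?powR_gt0//.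
  by split; apply: powR_homo => //; exact: ltW.
- split=> //; first by rewrite f00.
  have ZEle : 100 * E * s ^+ 3 <= f0 * g * Z.
    have -> : f0 * g * Z = 576 * E * s ^+ 3 * s ^+ 2.
      by rewrite -ZE; field; rewrite !gt_eqF.
    have Es : 0 < E * s ^+ 3 by rewrite mulr_gt0 ?exprn_gt0//; lra.
    have : E * s ^+ 3 * 1 <= E * s ^+ 3 * s ^+ 2.
      by rewrite ler_pM2l// exprn_ege1.
    have -> : 576 * E * s ^+ 3 * s ^+ 2 = 576 * (E * s ^+ 3 * s ^+ 2) by ring.
    rewrite -(mulrA 100); move: Es; set y := E * s ^+ 3; set z := y * s ^+ 2.
    by clear; move=> ? ?; lra.
  apply: (le_trans ZEle); rewrite (ler_pM2l (mulr_gt0 f00 g0)).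
  apply: (le_trans _ ZW).
  have Z1 : 1 <= Z.
    have Zfg : Z * (f0 * g) = 576 * (E * s ^+ 5).
      by rewrite -ZE; field; rewrite !gt_eqF.
    rewrite -(ler_pM2r (mulr_gt0 f00 g0)) mul1r Zfg.
    have fgE : f0 * g <= E by apply: le_trans gE; rewrite ler_piMl// ltW.
    have : E * 1 <= E * s ^+ 5 by rewrite ler_pM2l// exprn_ege1.
    move: fgE E0; set z := E * s ^+ 5; set w := f0 * g; clear; lra.
  have : Z * 1 <= Z * Z ^+ 3 by rewrite ler_pM2l// exprn_ege1.
  rewrite -exprS mulr1; move: Z0 ZW; set z := Z ^+ 4; clear; lra.
- move=> X n /andP[NX XM] XWn.
  have Xn : (X <= n)%N.
    rewrite -(@leq_pmul2l 2)// mulnC; apply: leq_trans XWn; by rewrite leq_mul2l Wn orbT.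
  have X0 : 0 < X%:R :> R by rewrite ltr0n (leq_trans _ NX)// ltnW.
  have n0 : 0 < n%:R :> R by rewrite (lt_le_trans X0)// ler_nat.
  have [[tn2 _ _ _] [_ _ c1 c4 cln]] := N0P n (leq_trans NX Xn).
  have tn0 : 0 < ln n%:R :> R by rewrite (lt_trans _ tn2)// ltr0n.
  rewrite powRr0 mulr1 in c1.
  split.
  + by rewrite /c_up mulrC -ler_pdivrMr// mul1r.
  + rewrite /c_up mulrA; apply: (le_trans c4).
    rewrite -[leRHS](lnK n0) -[leLHS](lnK (powR_gt0 _ tn0)) ln_powR.
    by rewrite ler_expR.
  have /andP[tX Xu] := lnu X NX XM.
  have := @polylog_dilution R beta X n be0; rewrite (leq_trans N1 NX) Xn.
  move=> /(_ isT (le_trans t8 tX)) dil.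
  have Xb : (ln X%:R `^ beta) <= u `^ beta.
    by apply: powR_homo => //; rewrite ltW// (lt_le_trans t0).
  have quarter : Num.sqrt (Num.sqrt (X%:R / n%:R)) <= Z^-1.
    rewrite -[leRHS](ger0_norm (ltW _)) ?invr_gt0// -sqrtr_sqr ler_wsqrtr//.
    rewrite -[leRHS](ger0_norm (sqr_ge0 _)) -sqrtr_sqr ler_wsqrtr//.
    rewrite -exprM exprVn ler_pdivrMr// mulrC ler_pdivlMr ?exprn_gt0//.
    have XWn' : X%:R * W%:R <= 2 * n%:R :> R by rewrite -!natrM ler_nat.
    have XZ : X%:R * (2 * Z ^+ (2 * 2)) <= X%:R * W%:R by rewrite ler_pM2l.
    by rewrite mulrCA in XZ; have := le_trans XZ XWn'; rewrite ler_pM2l ?ltr0n.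
  rewrite /c_up exprMn.
  apply: (@le_trans _ _ (36 * E * (B ^+ 2 * ((u `^ beta) ^+ 2 * Z^-1)))).
    rewrite -(mulrA (36 * E)) ler_pM2l; last by rewrite mulr_gt0// ltr0n.
    rewrite -mulrA ler_pM2l ?exprn_gt0//; apply: (le_trans dil).
    apply: ler_pM => //; rewrite ?sqr_ge0 ?sqrtr_ge0//.
    by rewrite ler_sqr ?nnegrE ?powR_ge0.
  have -> : B ^+ 2 * ((u `^ beta) ^+ 2 * Z^-1) = s ^+ 4 * Z^-1.
    by rewrite mulrA -exprMn -sE -exprM.
  rewrite le_eqVlt; apply/orP; left; apply/eqP; rewrite -ZE; field.
  by rewrite !gt_eqF.
- split => //.
  have -> : f0 * g / (16 * s) = A * g / (16 * b) * (u `^ (- (alpha + beta / 2))).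
    have ua0 : 0 < u `^ alpha by exact: powR_gt0.
    rewrite /f0 /s !powRN powRD; last by rewrite (gt_eqF u0) implybT.
    by field; rewrite !gt_eqF.
  have -> : A * g / (32 * b) / t = A * g / (16 * b) * u^-1.
    by rewrite /u; field; rewrite !gt_eqF.
  rewrite ler_pM2l; last by rewrite divr_gt0 ?mulr_gt0.
  rewrite -powR_inv1; last exact: ltW.
  by rewrite ler_powR ?lerN2// (le_trans (ltW t1)).
Unshelve. all: by end_near. Qed.

(** * Convergence *)

Lemma scalar_averaging_bounded (R : realType) (f c : nat -> R) (k : nat)
    (p : nat -> nat -> R) (x : nat -> R) :
  admissible f c k p -> scalar_averaging k p x ->
  exists2 D : R, 0 < D & forall j, (1 <= j)%N -> `|x j| <= D.
Proof.
move=> adm avg; pose D : R := 1 + \sum_(1 <= j < k.+1) `|x j|.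
have S0 : 0 <= \sum_(1 <= j < k.+1) `|x j| by apply: sumr_ge0.
exists D; first by rewrite ltr_pwDl.
elim/ltn_ind => -[//|n] IH _.
have [nk|kn] := leqP n.+1 k.
  rewrite /D (bigD1_seq n.+1) ?iota_uniq ?mem_index_iota//=.
  by rewrite addrCA lerDl addr_ge0// sumr_ge0.
have [[p0 p1] _] := adm n kn.
rewrite avg// (le_trans (ler_norm_sum _ _ _))//.
rewrite -[leRHS]mul1r -p1 mulr_suml; apply: ler_sum_nat => j /andP[j1 jn].
rewrite normrM ger0_norm ?p0 ?j1//; apply: ler_wpM2l; first by rewrite p0 ?j1.
exact: IH.
Qed.

Lemma lnlnln_unbounded (R : realType) (Y : R) :
  exists M : nat, forall n, (M <= n)%N -> Y < ln (ln (ln n%:R)).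
Proof.
apply: (@near_ln R (fun t => Y < ln (ln t))); near=> t.
have tY : expR (expR Y) < t by near: t; exact: nbhs_pinfty_gt.
have t0 : 0 < t := lt_trans (expR_gt0 _) tY.
have lt0 : expR Y < ln t by rewrite -[ltLHS]expRK ltr_ln ?posrE ?expR_gt0.
by rewrite -[ltLHS]expRK ltr_ln ?posrE ?expR_gt0// (lt_trans _ lt0)// expR_gt0.
Unshelve. all: by end_near. Qed.

Lemma lnln_increment_le (R : realType) (t h : R) : 1 < t -> 0 <= h ->
  ln (ln (t + h)) - ln (ln t) <= h / (t * ln t).
Proof.
move=> t1 h0; have t0 : 0 < t by lra.
have l0 : 0 < ln t by rewrite ln_gt0.
have th0 : 0 < t + h by lra.
have lth : 0 < ln (t + h) by rewrite ln_gt0//; lra.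
rewrite -ln_div ?posrE//; apply: (le_trans (ln_le_sub1 _)); first exact: divr_gt0.
have -> : ln (t + h) / ln t - 1 = (ln (t + h) - ln t) / ln t.
  by rewrite mulrBl divff ?gt_eqF.
rewrite invfM mulrA ler_pM2r ?invr_gt0// -ln_div ?posrE//.
apply: (le_trans (ln_le_sub1 _)); first exact: divr_gt0.
by rewrite mulrDl divff ?gt_eqF// addrAC subrr add0r.
Qed.

(** Otherwise U - L + Psi N, with Psi proportional to ln ln ln N, is
    nonincreasing along a sequence of indices N that tends to infinity. *)
Lemma scalar_range_small (R : realType) (A B alpha beta g : R) (k : nat)
    (p : nat -> nat -> R) (x : nat -> R) :
  0 < A -> 0 < B -> 0 < alpha -> 0 < beta -> alpha + beta / 2 <= 1 ->
  admissible (f_low A alpha) (c_up B beta) k p -> scalar_averaging k p x ->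
  0 < g ->
  exists (N : nat) (L U : R), (forall j, (N <= j)%N -> L <= x j <= U) /\ U - L < g.
Proof.
move=> A0 B0 al0 be0 ab1 adm avg g0; apply: contrapT => noN.
have wide N L U : (forall j, (N <= j)%N -> L <= x j <= U) -> g <= U - L.
  by move=> env; rewrite leNgt; apply/negP => gUL; apply: noN; exists N, L, U.
have [D D0 xD] := scalar_averaging_bounded adm avg.
pose E := 2 * D + g; have gE : 0 < g <= E by rewrite g0 /E; lra.
have [eta [K [N0 [eta0 K0 params]]]] :=
  drop_parameters A0 B0 al0 be0 ab1 gE.
pose Psi N : R := eta / (3 * K) * ln (ln (ln N%:R)).
pose N1 := maxn N0 (maxn k 1).
have [V potential] : exists V, forall M, exists N L U,
    [/\ (maxn M N1 <= N)%N, forall j, (N <= j)%N -> L <= x j <= U &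
        U - L + Psi N <= V].
  exists (D + D + Psi N1); elim=> [|M [N [L [U [MN env pot]]]]].
    exists N1, (- D), D; rewrite max0n opprK; split => // j N1j.
    rewrite -ler_norml; apply: xD; apply: leq_trans N1j.
    by rewrite /N1 !leq_max ltnSn !orbT.
  have [N0N kN N11] : [/\ (N0 <= N)%N, (k <= N)%N & (1 <= N)%N].
    by move: MN; rewrite /N1 !geq_max => /and4P[_ -> -> ->].
  have [t1 [W [s [f0 [W2 fc [s4 f01 hW] spread [drop lnW]]]]]] := params N N0N.
  set t := ln N%:R in t1 drop lnW.
  have NN' : (N < N * W ^ 3)%N.
    by rewrite -[ltnLHS]muln1 ltn_pmul2l// -(exp1n 3) ltn_exp2r.
  have xE j : (1 <= j)%N -> L - E <= x j <= U + E.
    move=> j1; have := xD j j1; have := xD N N11; have := env N (leqnn N).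
    by rewrite !ler_norml /E => /andP[? ?] /andP[? ?] /andP[? ?]; lra.
  have [L' [U' [env' UL]]] := range_shrinks adm avg N11 kN W2 fc s4 f01 gE
    (wide _ _ _ env) hW spread xE env.
  exists (N * W ^ 3)%N, L', U'; split; [|exact: env'|].
    move/(leq_trans _) in MN.
    have [MN' N1N] := (MN _ (leq_maxl M N1), MN _ (leq_maxr M N1)).
    by rewrite geq_max (leq_ltn_trans MN' NN') (leq_trans N1N (ltnW NN')).
  suff : Psi (N * W ^ 3)%N - Psi N <= f0 * g / (16 * s) by lra.
  apply: le_trans drop.
  have W0 : 0 < W%:R :> R by rewrite ltr0n ltnW.
  have Np : 0 < N%:R :> R by rewrite ltr0n.
  have lnt0 : 0 < ln t by rewrite ln_gt0.
  have lnW0 : 0 <= ln (W%:R : R) by rewrite ln_ge0// ler1n ltnW.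
  have -> : Psi (N * W ^ 3)%N = eta / (3 * K) * ln (ln (t + 3 * ln W%:R)).
    rewrite /Psi natrM natrX lnM ?posrE ?exprn_gt0// lnXn// -/t.
    by rewrite -[ln W%:R *+ 3]mulr_natl.
  rewrite /Psi -/t -mulrBr.
  apply: (@le_trans _ _ (eta / (3 * K) * (3 * K / t))).
    apply: ler_wpM2l; first by rewrite divr_ge0 ?mulr_ge0// ltW.
    apply: (le_trans (lnln_increment_le t1 _)); first by rewrite mulr_ge0.
    have t0 : 0 < t by lra.
    rewrite ler_pdivrMr ?mulr_gt0//.
    have -> : 3 * K / t * (t * ln t) = 3 * (K * ln t) by field; rewrite gt_eqF.
    by rewrite ler_pM2l.
  by rewrite le_eqVlt; apply/orP; left; apply/eqP; field; rewrite !gt_eqF//; lra.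
have [M VM] := lnlnln_unbounded (V / (eta / (3 * K))).
have [N [L [U [MN env pot]]]] := potential M.
have NM : (M <= N)%N by apply: leq_trans MN; exact: leq_maxl.
have := VM N NM; rewrite ltr_pdivrMr; last by rewrite divr_gt0 ?mulr_gt0.
have := wide _ _ _ env; rewrite mulrC -/(Psi N); lra.
Qed.

Lemma scalar_averaging_cvg (R : realType) (A B alpha beta : R) (k : nat)
    (p : nat -> nat -> R) (x : nat -> R) :
  0 < A -> 0 < B -> 0 < alpha -> 0 < beta -> alpha + beta / 2 <= 1 ->
  admissible (f_low A alpha) (c_up B beta) k p -> scalar_averaging k p x ->
  cvg (x n @[n --> \oo]).
Proof.
move=> A0 B0 al0 be0 ab1 adm avg; apply/cauchy_cvgP/cauchy_exP => e e0.
have [N [L [U [env UL]]]] := scalar_range_small A0 B0 al0 be0 ab1 adm avg e0.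
exists (x N), N => // j /= Nj; rewrite /ball/=.
have /andP[? ?] := env N (leqnn N); have /andP[? ?] := env j Nj.
by rewrite ltr_norml; lra.
Qed.

Lemma rV_seq_cvg (R : realType) (d : nat) (a : nat -> 'rV[R]_d) :
  (forall i, cvg (a n 0 i @[n --> \oo])) -> cvg (a n @[n --> \oo]).
Proof.
move=> acvg; apply/cvg_ex; exists (\row_i lim (a n 0 i @[n --> \oo])).
apply/cvg_mx_entourageP => V entV.
apply: filter_forall => i; apply: filter_forall => j.
rewrite ord1 mxE; have /cvg_entourageP/(_ V entV) := acvg j.
move=> near_lim; have {}near_lim : \forall n \near \oo,
    V (lim (a n 0 j @[n --> \oo]), a n 0 j) by exact: near_lim.
by apply: filterS near_lim => n; exact: mem_set.
Qed.

Lemma averaging_coord (R : realType) (d k : nat) (p : nat -> nat -> R)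
    (a : nat -> 'rV[R]_d) (i : 'I_d) :
  averaging_sequence k p a -> scalar_averaging k p (fun n => a n 0 i).
Proof.
move=> avg n kn; rewrite avg// summxE; apply: eq_bigr => j _.
by rewrite mxE.
Qed.

(** * Oscillation *)

(** Course-of-values recursion: stage n holds a whole sequence, correct up to
    index n. *)
Lemma scalar_averaging_exists (R : realType) (k : nat) (p : nat -> nat -> R)
    (x0 : nat -> R) :
  exists2 x : nat -> R, scalar_averaging k p x & forall j, (j <= k)%N -> x j = x0 j.
Proof.
pose fix st (n : nat) : nat -> R :=
  if n is m.+1 then
    if (m < k)%N then st m
    else fun j => if j == m.+1 then \sum_(1 <= i < m.+1) p m i * st m i else st m j
  else x0.
have st_stable n j : (j <= n)%N -> st n j = st j j.
  elim: n => [|n IH]; first by rewrite leqn0 => /eqP->.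
  rewrite leq_eqVlt => /orP[/eqP->//|]; rewrite ltnS => jn /=.
  by case: ifP => _; rewrite ?(ltn_eqF (_ : j < n.+1)%N)// IH.
have st_init n : (n <= k)%N -> st n = x0.
  by elim: n => //= n IH nk; rewrite nk IH// ltnW.
exists (fun j => st j j) => [n kn|j jk]; last by rewrite st_init.
rewrite /= ltnNge kn/= eqxx; apply: eq_big_nat => j /andP[_ jn].
by rewrite st_stable.
Qed.

Lemma phase_index (h : nat -> nat) : {homo h : i j / (i < j)%N} ->
  exists phi : nat -> nat, forall i n, (h i <= n < h i.+1)%N -> phi n = i.
Proof.
move=> hinc; have hmono : {homo h : i j / (i <= j)%N} := ltnW_homo hinc.
suff /choice[phi phiP] : forall n, exists i, forall i',
    (h i' <= n < h i'.+1)%N -> i = i' by exists phi => i n; exact: phiP.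
move=> n; have [[i /andP[hn nh]]|none] :=
    pselect (exists i, (h i <= n < h i.+1)%N); last first.
  by exists 0%N => i hi; exfalso; apply: none; exists i.
exists i => i' /andP[hn' nh']; have [ii'|ii'|//] := ltngtP i i'.
  by have := leq_trans nh (leq_trans (hmono _ _ ii') hn'); rewrite ltnn.
by have := leq_trans nh' (leq_trans (hmono _ _ ii') hn); rewrite ltnn.
Qed.

Lemma phase_cover (h : nat -> nat) (n : nat) : {homo h : i j / (i < j)%N} ->
  (h 0%N <= n)%N -> exists i, (h i <= n < h i.+1)%N.
Proof.
move=> hinc h0n.
have unbounded i : (i <= h i)%N.
  by elim: i => // i IH; exact: leq_ltn_trans (hinc _ _ (ltnSn i)).
have ex : exists i, (n < h i)%N by exists n.+1.
case: (ex_minnP ex) => -[|i] nhi min_i; first by rewrite ltnNge h0n in nhi.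
exists i; rewrite nhi andbT leqNgt; apply/negP => /min_i.
by rewrite ltnn.
Qed.

Lemma sum_window (R : realType) (n lo hi : nat) (G : nat -> R) : (hi <= n)%N ->
  \sum_(1 <= j < n.+1) (if (lo < j <= hi)%N then G j else 0) =
  \sum_(lo.+1 <= j < hi.+1) G j.
Proof.
move=> hin.
have [lohi|hilo] := leqP lo hi; last first.
  rewrite [RHS]big_geq; last by rewrite ltnS ltnW.
  rewrite big1// => j _; case: ifP => // /andP[a b].
  by have := leq_trans a (leq_trans b (ltnW hilo)); rewrite ltnn.
rewrite (@big_cat_nat _ _ _ lo.+1)//=; last by rewrite ltnS (leq_trans lohi).
rewrite (@big_cat_nat _ _ _ hi.+1 lo.+1)//=.
rewrite [X in X + _]big_nat big1 ?add0r; last first.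
  by move=> j /andP[_]; rewrite ltnS leqNgt => /negbTE->.
rewrite [X in _ + X]big_nat [X in _ + X]big1 ?addr0; last first.
  by move=> j /andP[a _]; rewrite [(j <= hi)%N]leqNgt a andbF.
by apply: eq_big_nat => j /andP[-> jh]; rewrite -ltnS jh.
Qed.

(** One phase [N, M) aiming at b, fed by the block (h, 2 h]. The sum u n of the
    excess of the deviations over w satisfies u (n + 1) <= u n (1 + F / n), so
    it stays below N (n / N)^(2 F), hence below 2 N: the initial
    deviation is forgotten like N / n. *)
Lemma phase_deviation (R : realType) (x : nat -> R) (b F w : R) (f : nat -> R)
    (h N M : nat) :
  (0 < h)%N -> (0 < N)%N -> 0 <= w -> 
  (forall n, (N <= n < M)%N -> 0 <= f n <= F) -> F <= 1 ->
  F * (ln M%:R - ln N%:R) <= 4^-1 ->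
  (forall j, (1 <= j <= N)%N -> `|x j - b| <= 1) ->
  (forall j, (h < j <= h.*2)%N -> `|x j - b| <= w) ->
  (forall n, (N <= n < M)%N -> x n.+1 =
    f n / n%:R * (\sum_(1 <= j < n.+1) x j) +
    (1 - f n) / h%:R * (\sum_(h.+1 <= j < h.*2.+1) x j)) ->
  forall n, (N <= n < M)%N -> `|x n.+1 - b| <= w + 2 * F * N%:R / n%:R.
Proof.
move=> h0 N0 w0 fF F1 FM xN xT step.
have Np : 0 < N%:R :> R by rewrite ltr0n.
have hp : 0 < h%:R :> R by rewrite ltr0n.
pose u n := \sum_(1 <= j < n.+1) (`|x j - b| - w).
pose G n := N%:R * expR (2 * F * (ln n%:R - ln N%:R)).
have G0 n : 0 <= G n by rewrite mulr_ge0 ?expR_ge0.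
have dev n : (N <= n < M)%N -> `|x n.+1 - b| <= w + f n / n%:R * u n.
  move=> nM; have /andP[f0 f1] := fF n nM; have /andP[Nn _] := nM.
  have np : 0 < n%:R :> R by rewrite ltr0n (leq_trans N0).
  have -> : x n.+1 - b = f n / n%:R * (\sum_(1 <= j < n.+1) (x j - b)) +
      (1 - f n) / h%:R * (\sum_(h.+1 <= j < h.*2.+1) (x j - b)).
    rewrite step// !sumrB !sumr_const_nat subn1 /=.
    rewrite (_ : (h.*2.+1 - h.+1)%N = h); last by rewrite subSS -addnn addnK.
    by rewrite -[b *+ n]mulr_natl -[b *+ h]mulr_natl; field; rewrite !gt_eqF.
  have fn0 : 0 <= f n / n%:R by rewrite divr_ge0// ltW.
  have fh0 : 0 <= (1 - f n) / h%:R by rewrite divr_ge0 ?(ltW hp)// subr_ge0 (le_trans f1).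
  rewrite (le_trans (ler_normD _ _))// (normrM (f n / _)) (normrM ((1 - f n) / _)) (ger0_norm fn0) (ger0_norm fh0).
  have s1 : f n / n%:R * `|\sum_(1 <= j < n.+1) (x j - b)| <=
      f n / n%:R * (u n + n%:R * w).
    apply: ler_wpM2l => //; apply: (le_trans (ler_norm_sum _ _ _)).
    by rewrite /u sumrB sumr_const_nat subn1 /= -[w *+ n]mulr_natl subrK.
  have s2 : (1 - f n) / h%:R * `|\sum_(h.+1 <= j < h.*2.+1) (x j - b)| <=
      (1 - f n) / h%:R * (h%:R * w).
    apply: ler_wpM2l => //; apply: (le_trans (ler_norm_sum _ _ _)).
    apply: (@le_trans _ _ (\sum_(h.+1 <= j < h.*2.+1) w)).
      by apply: ler_sum_nat => j /andP[hj jh]; apply: xT; rewrite hj -ltnS.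
    rewrite sumr_const_nat subSS -addnn addnK -[w *+ h]mulr_natl.
    exact: lexx.
  have e1 : f n / n%:R * (u n + n%:R * w) = f n / n%:R * u n + f n * w.
    by field; rewrite gt_eqF.
  have e2 : (1 - f n) / h%:R * (h%:R * w) = w - f n * w by field; rewrite gt_eqF.
  by move: s1 s2; rewrite e1 e2; lra.
have uG n : (N <= n)%N -> (n <= M)%N -> u n <= G n.
  elim: n => [|n IH]; first by rewrite leqn0 => /eqP N00; rewrite N00 in N0.
  rewrite leq_eqVlt => /orP[/eqP<- _|].
    rewrite /G subrr mulr0 expR0 mulr1 /u.
    apply: (@le_trans _ _ (\sum_(1 <= j < N.+1) 1)).
      apply: ler_sum_nat => j jN; have := xN j jN; lra.
    by rewrite sumr_const_nat subn1.
  rewrite ltnS => Nn nM; have nNM : (N <= n < M)%N by rewrite Nn.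
  have np : 0 < n%:R :> R by rewrite ltr0n (leq_trans N0).
  have /andP[f0 f1] := fF n nNM.
  have fn0 : 0 <= f n / n%:R by rewrite divr_ge0// ltW.
  have -> : u n.+1 = u n + (`|x n.+1 - b| - w) by rewrite /u big_nat_recr.
  apply: (@le_trans _ _ (u n * (1 + f n / n%:R))).
    by have := dev n nNM; rewrite mulrDr mulr1 mulrC; lra.
  apply: (@le_trans _ _ (G n * (1 + f n / n%:R))).
    by rewrite ler_wpM2r ?IH// ?(ltnW nM)// addr_ge0.
  rewrite /G -mulrA ler_pM2l//.
  apply: (@le_trans _ _ (expR (2 * F * (ln n%:R - ln N%:R)) * expR (f n / n%:R))).
    by rewrite ler_wpM2l ?expR_ge0// expR_ge1Dx.
  rewrite -expRD ler_expR -[leRHS](_ : 2 * F * (ln n%:R - ln N%:R) +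
     2 * F * (ln n.+1%:R - ln n%:R) = _); last by ring.
  rewrite lerD2l.
  have Sp : 0 < n.+1%:R :> R by rewrite ltr0n.
  have n1 : 1 <= n%:R :> R by rewrite ler1n (leq_trans N0).
  have lnS : n%:R^-1 <= 2 * (ln n.+1%:R - ln n%:R) :> R.
    have lnq := ln_le_sub1 (divr_gt0 np Sp); rewrite ln_div ?posrE// in lnq.
    apply: (@le_trans _ _ (2 * (1 - n%:R / n.+1%:R))); last first.
      by rewrite ler_pM2l// -lerN2 !opprB.
    have -> : 1 - n%:R / n.+1%:R = n.+1%:R^-1 :> R.
      by rewrite -natr1; field; rewrite natr1 gt_eqF.
    rewrite ler_pdivlMr// mulrC ler_pdivrMr// -natr1; lra.
  have F0 : 0 <= F by exact: le_trans f1.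
  apply: (@le_trans _ _ (F * n%:R^-1)); first by rewrite ler_pM2r ?invr_gt0.
  by rewrite -mulrA mulrCA ler_wpM2l.
move=> n nM; have /andP[Nn nM'] := nM.
have np : 0 < n%:R :> R by rewrite ltr0n (leq_trans N0).
have /andP[f0 f1] := fF n nM.
have F0 : 0 <= F by exact: le_trans f1.
apply: (le_trans (dev n nM)); rewrite lerD2l.
have G2 : G n <= N%:R * 2.
  rewrite ler_pM2l//; apply: (@le_trans _ _ (expR (2^-1))).
    rewrite ler_expR; apply: (@le_trans _ _ (2 * (F * (ln M%:R - ln N%:R)))).
      rewrite -mulrA ler_pM2l// ler_wpM2l// lerB// ler_ln ?posrE//.
        by rewrite ler_nat ltnW.
      by rewrite ltr0n (leq_trans _ nM')// ltnW// (leq_trans N0 Nn).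
    by lra.
  rewrite -[expR _]invrK -expRN -[leRHS]invrK lef_pV2 ?posrE ?invr_gt0 ?expR_gt0//.
  have := expR_ge1Dx (- 2^-1 : R); lra.
apply: (@le_trans _ _ (f n / n%:R * (N%:R * 2))).
  by rewrite ler_wpM2l ?divr_ge0 ?(ltW np)// (le_trans (uG _ Nn (ltnW nM'))).
have -> : f n / n%:R * (N%:R * 2) = f n * (2 * N%:R / n%:R) by ring.
have -> : 2 * F * N%:R / n%:R = F * (2 * N%:R / n%:R) by ring.
by rewrite ler_wpM2r// divr_ge0// mulr_ge0.
Qed.

(** Phase i + 1 consists of the n with 2 h (i + 1) <= n < 2 h (i + 2), feeds on
    the block (h i, 2 h i], and fills the block (h (i + 2), 2 h (i + 2)]. Blocks
    of even index aim at 0, those of odd index at 1, and S i bounds the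
    deviation on block i. *)
Lemma oscillating_sequence (R : realType) (f c : nat -> R) (h rho : nat -> nat)
    (F S : nat -> R) :
  (0 < h 0)%N -> (forall i, (2 <= rho i)%N) ->
  (forall i, h i.+1 = h i * rho i)%N ->
  (forall i n, ((h i.+1).*2 <= n < (h i.+2).*2)%N ->
     0 <= f n <= F i.+1 /\ n%:R / (h i)%:R + 1 <= c n) ->
  (forall i, 0 <= F i <= 1) ->
  (forall i, F i * ln (rho i)%:R <= 4^-1) ->
  0 <= S 0%N -> (forall i, S i <= 4^-1) ->
  (forall i, S i + 4 * F i / (rho i)%:R <= S i.+1) ->
  exists (k : nat) (p : nat -> nat -> R) (x : nat -> R),
    [/\ (2 <= k)%N, admissible f c k p, scalar_averaging k p x &
        ~ cvg (x n @[n --> \oo])].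
Proof.
move=> h00 rho2 hS fc F1 Frho S0 S4 SS.
have h0 i : (0 < h i)%N.
  by elim: i => // i IH; rewrite hS muln_gt0 IH (ltn_trans _ (rho2 i)).
have hdouble i : ((h i).*2 <= h i.+1)%N by rewrite hS -muln2 leq_mul2l rho2 orbT.
have hinc : {homo (fun i => (h i).*2) : i j / (i < j)%N}.
  apply: homo_ltn; first exact: ltn_trans.
  move=> i; rewrite ltn_double; apply: leq_trans (hdouble i).
  by rewrite -addnn -[ltnLHS]addn0 ltn_add2l.
have hmono : {homo (fun i => (h i).*2) : i j / (i <= j)%N} := ltnW_homo hinc.
have hlarge i : (i <= (h i).*2)%N.
  by elim: i => // i IH; exact: leq_ltn_trans (hinc _ _ (ltnSn i)).
have [phi phiP] := phase_index hinc.
pose T n := h (phi n).-1.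
pose p n j : R := f n / n%:R +
  (if (T n < j <= (T n).*2)%N then (1 - f n) / (T n)%:R else 0).
pose k := (h 1%N).*2.
have phase n : (k <= n)%N -> exists i,
    [/\ ((h i.+1).*2 <= n < (h i.+2).*2)%N, T n = h i & ((h i).*2 <= n)%N].
  move=> kn; have hn0 : ((h 0%N).*2 <= n)%N by exact: leq_trans (hmono _ _ (leqnSn 0)) kn.
  have [[|i] hin] := phase_cover hinc hn0.
    by move: hin; rewrite [X in _ && X]ltnNge kn andbF.
  exists i; split=> //; first by rewrite /T (phiP i.+1 n hin).
  by have /andP[hn _] := hin; exact: leq_trans (hmono _ _ (leqnSn i)) hn.
have pE n (G : nat -> R) : (k <= n)%N -> \sum_(1 <= j < n.+1) p n j * G j =
    f n / n%:R * (\sum_(1 <= j < n.+1) G j) +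
    (1 - f n) / (T n)%:R * (\sum_((T n).+1 <= j < (T n).*2.+1) G j).
  move=> kn; have [i [_ TE Tn]] := phase n kn.
  rewrite [in X in _ + X]mulr_sumr -(@sum_window _ n (T n) (T n).*2); last by rewrite TE.
  rewrite mulr_sumr -big_split/=; apply: eq_bigr => j _.
  by rewrite /p mulrDl; case: ifP => _; rewrite ?mul0r.
have k2 : (2 <= k)%N by rewrite /k -[2%N]/(1.*2) leq_double.
have fb n : (k <= n)%N -> 0 <= f n <= 1.
  move=> kn; have [i [hin _ _]] := phase n kn.
  by have [/andP[-> fF] _] := fc i n hin; rewrite (le_trans fF)//; have /andP[] := F1 i.+1.
have prob n : (k <= n)%N -> is_prob_on n (p n).
  move=> kn; have /andP[f0 f1] := fb n kn; split.
    move=> j _; rewrite /p addr_ge0 ?divr_ge0//; case: ifP => // _.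
    by rewrite divr_ge0// subr_ge0.
  have np : 0 < n%:R :> R by rewrite ltr0n (leq_trans _ kn)// ltnW.
  have [i [_ TE _]] := phase n kn.
  have Tp : 0 < (T n)%:R :> R by rewrite ltr0n TE.
  have := pE n (fun=> 1) kn; under eq_bigr do rewrite mulr1.
  move=> ->; rewrite !sumr_const_nat subn1/= subSS -addnn addnK.
  by field; rewrite !gt_eqF.
have adm : admissible f c k p.
  move=> n kn; split; first exact: prob.
  move=> j _; have /andP[f0 f1] := fb n kn; have [i [hin TE _]] := phase n kn.
  have np : 0 < n%:R :> R by rewrite ltr0n (leq_trans _ kn)// ltnW.
  have hp : 0 < (h i)%:R :> R by rewrite ltr0n.
  have extra : 0 <= (1 - f n) / (h i)%:R by rewrite divr_ge0// subr_ge0.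
  rewrite /p TE; split; first by rewrite lerDl; case: ifP.
  have [_ cn] := fc i n hin.
  apply: (@le_trans _ _ (f n / n%:R + (1 - f n) / (h i)%:R)).
    by rewrite lerD2l; case: ifP.
  rewrite ler_pdivlMr// mulrDl divfK ?gt_eqF//.
  apply: le_trans cn; rewrite addrC lerD//.
  by rewrite mulrAC ler_pM2r ?invr_gt0// -[leRHS]mul1r ler_pM2r// gerBl.
(* the blocks 0 and 1 are given exactly *)
pose init j : R := if (j <= (h 0%N).*2)%N then 0 else 1.
have [x avg xinit] := @scalar_averaging_exists _ k p init.
have x01 j : (1 <= j)%N -> 0 <= x j <= 1.
  elim/ltn_ind: j => -[//|n] IH _; have [nk|kn] := leqP n.+1 k.
    by rewrite xinit// /init; case: ifP => _; rewrite ?lexx ?ler01.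
  have [p0 p1] := prob n kn; rewrite avg//; apply/andP; split.
    rewrite big_nat; apply: sumr_ge0 => j /andP[j1 jn].
    rewrite mulr_ge0 ?p0 ?j1//; by have /andP[] := IH j jn j1.
  rewrite -p1; apply: ler_sum_nat => j /andP[j1 jn].
  by rewrite ler_piMr ?p0 ?j1//; have /andP[] := IH j jn j1.
have dev01 (b : bool) j : (1 <= j)%N -> `|x j - b%:R| <= 1.
  by move=> /x01; rewrite ler_norml; case: b => /= /andP[? ?]; lra.
have F0 i : 0 <= F i by have /andP[] := F1 i.
have SM i : S i <= S i.+1.
  by apply: le_trans (SS i); rewrite lerDl divr_ge0 ?mulr_ge0.
have S00 i : 0 <= S i by elim: i => // i IH; exact: le_trans (SM i).
have dev i : (forall j, (h i < j <= (h i).*2)%N -> `|x j - (odd i)%:R| <= S i) /\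
    (forall j, (h i.+1 < j <= (h i.+1).*2)%N -> `|x j - (odd i.+1)%:R| <= S i.+1).
  elim: i => [|i [IH0 IH1]]; split=> //.
  - move=> j /andP[_ j0]; rewrite xinit ?(leq_trans j0) ?hmono// /init j0.
    by rewrite subrr normr0.
  - move=> j /andP[h1j jk]; rewrite xinit// /init leqNgt (leq_ltn_trans _ h1j)//.
    by rewrite subrr normr0.
  case=> // n /andP[hn nh].
  have hp : 0 < (h i.+1)%:R :> R by rewrite ltr0n.
  have nin : ((h i.+1).*2 <= n < (h i.+2).*2)%N.
    by rewrite (leq_trans (hdouble _))//= -ltnS.
  have kn : (k <= n)%N.
    by have /andP[hin _] := nin; apply: leq_trans hin; exact: (hmono 1%N).
  have /andP[nN nM] := nin.
  have n0 : (0 < n)%N := leq_trans (ltnW k2) kn.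
  have np : 0 < n%:R :> R by rewrite ltr0n.
  have rp : 0 < (rho i.+1)%:R :> R by rewrite ltr0n (leq_trans _ (rho2 i.+1)).
  have := @phase_deviation R x (odd i)%:R (F i.+1) (S i) f (h i)
    (h i.+1).*2 (h i.+2).*2 (h0 i) _ (S00 i) _ _ _ _ _ _ n nin.
  rewrite /= negbK => dev; apply: (le_trans (dev _ _ _ _ _ _ _)) => //.
  - by rewrite double_gt0.
  - by move=> m /fc[].
  - by have /andP[] := F1 i.+1.
  - have -> : ln ((h i.+2).*2)%:R - ln ((h i.+1).*2)%:R = ln (rho i.+1)%:R :> R.
      have h2p : 0 < ((h i.+1).*2)%:R :> R by rewrite ltr0n double_gt0.
      by rewrite (hS i.+1) -muln2 mulnAC muln2 natrM lnM ?posrE// addrAC subrr add0r.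
    exact: Frho.
  - by move=> j /andP[j1 _]; exact: dev01.
  - move=> m min; have /andP[mN mM] := min.
    have km : (k <= m)%N by apply: leq_trans mN; exact: (hmono 1%N).
    rewrite avg// pE//; have [i' [m1 -> _]] := phase m km.
    suff -> : i' = i by [].
    by have := phiP _ _ m1; rewrite (phiP _ _ min) => -[].
  - apply: le_trans (SS i.+1); apply: lerD (SM i) _.
      have -> : 4 * F i.+1 / (rho i.+1)%:R =
          2 * F i.+1 * ((h i.+1).*2)%:R / (h i.+2)%:R.
        by rewrite (hS i.+1) -muln2 !natrM; field; rewrite !gt_eqF.
      rewrite ler_wpM2l ?mulr_ge0// lef_pV2 ?posrE ?ltr0n//.
      by rewrite ler_nat -ltnS.
exists k, p, x; split => //.
move=> /cvg_ex[l /cvgrPdist_lt/(_ 8^-1)]; rewrite invr_gt0 ltr0n => /(_ isT)[M _ near_l].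
have ends m : (M <= m)%N -> `|l - (odd m)%:R| < 2^-1.
  move=> Mm; have hm : (M <= (h m).*2)%N := leq_trans Mm (hlarge m).
  have := near_l _ hm => /=; have [+ _] := dev m.
  move=> /(_ (h m).*2); rewrite -addnn leqnn andbT -[ltnLHS]addn0 ltn_add2l h0 => /(_ isT) d1 d2.
  have := ler_distD (x (h m + h m)%N) l (odd m)%:R; have := S4 m.
  lra.
have e1 := ends M (leqnn M); have e2 := ends M.+1 (leqnSn M).
move: e1 e2; rewrite /= !ltr_norml; case: (odd M) => /=; lra.
Qed.

(** Tangent line inequality for the convex function t^-sigma at t + 1 / 2; its
    telescoping sums bound the sums of t^-(sigma + 1). *)
Lemma powR_decrement_ge (R : realType) (sigma t t' : R) :
  0 < sigma -> 1 <= t -> t + 2^-1 <= t' ->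
  sigma / 2 * (2 * t) `^ (- (sigma + 1)) <= t `^ (- sigma) - t' `^ (- sigma).
Proof.
move=> s0 t1 tt'; pose v := t + 2^-1.
have t0 : 0 < t by lra.
have v0 : 0 < v by rewrite /v; lra.
have v2 : v <= 2 * t by rewrite /v; lra.
have decr (a b r : R) : 0 < a -> a <= b -> 0 <= r -> b `^ (- r) <= a `^ (- r).
  move=> a0 ab r0; rewrite !powRN lef_pV2 ?posrE ?powR_gt0 ?(lt_le_trans a0)//.
  exact: powR_homo (ltW a0) ab.
have tangent : v `^ (- sigma) * (1 + sigma * (1 - t / v)) <= t `^ (- sigma).
  have -> : t `^ (- sigma) = v `^ (- sigma) * (t / v) `^ (- sigma).
    rewrite -powRM ?divr_ge0 ?(ltW t0) ?(ltW v0)//.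
    by rewrite mulrC divfK ?gt_eqF.
  rewrite ler_pM2l ?powR_gt0//.
  have tv : 0 < t / v by exact: divr_gt0.
  rewrite -[leRHS]lnK ?posrE ?powR_gt0// ln_powR.
  apply: (le_trans _ (expR_ge1Dx _)); rewrite lerD2l mulNr -mulrN ler_pM2l//.
  have := ln_le_sub1 tv; lra.
have v1E : v `^ (- (sigma + 1)) = v `^ (- sigma) * v^-1.
  rewrite opprD powRD; last by rewrite (gt_eqF v0) implybT.
  by rewrite [v `^ (-1)]powR_inv1// ltW.
apply: (@le_trans _ _ (sigma / 2 * v `^ (- (sigma + 1)))).
  by rewrite ler_wpM2l ?divr_ge0 ?(ltW s0)// decr//; lra.
have -> : sigma / 2 * v `^ (- (sigma + 1)) =
    v `^ (- sigma) * (1 + sigma * (1 - t / v)) - v `^ (- sigma).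
  rewrite v1E /v; field; rewrite gt_eqF//; rewrite /v in v0; lra.
by apply: lerB => //; apply: decr => //; exact: ltW.
Qed.

(** With rho close to sqrt c / 2, the bound 2 rho^2 + 1 <= c holds, and f / rho
    is of order t^-(sigma + 1) with sigma = alpha + beta / 2 - 1 > 0. The
    deviation bound S i telescopes as Q (t_0^-sigma - t_i^-sigma). *)
Lemma scalar_oscillation (R : realType) (A B alpha beta : R) :
  0 < A -> 0 < B -> 0 < alpha -> 0 < beta -> 1 < alpha + beta / 2 ->
  exists (k : nat) (p : nat -> nat -> R) (x : nat -> R),
    [/\ (2 <= k)%N, admissible (f_low A alpha) (c_up B beta) k p,
        scalar_averaging k p x & ~ cvg (x n @[n --> \oo])].
Proof.
move=> A0 B0 al0 be0 ab1.
pose sigma := alpha + beta / 2 - 1; have s0 : 0 < sigma by rewrite subr_gt0.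
pose b := Num.sqrt B; have b0 : 0 < b by rewrite sqrtr_gt0.
(* Q makes the bound of [powR_decrement_ge] equal to 16 f / sqrt c *)
pose Q := 16 * A / b * (2 / sigma) * 2 `^ (sigma + 1).
have Q0 : 0 <= Q.
  by rewrite /Q !mulr_ge0 ?powR_ge0 ?invr_ge0 ?ler0n ?ltW.
pose f := f_low A alpha; pose c := c_up B beta.
pose large (t : R) := [/\ 1 < t, 16 / B * t `^ 0 <= t `^ beta,
    A * t `^ (- alpha) <= t `^ 0 &
    4 * A * (beta + 1) * (2 / alpha) * t `^ (- (alpha / 2)) <= t `^ 0] /\
  B * t `^ beta <= t `^ (beta + 1) /\ 4 * Q * t `^ (- sigma) <= t `^ 0.
have [N0 N0P] : exists N0 : nat, forall n, (N0 <= n)%N -> large (ln n%:R).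
  apply: near_ln; near=> t; split; [split|split]; near: t.
  - exact: nbhs_pinfty_gt.
  - exact: powR_dominates.
  - by apply: powR_dominates; rewrite oppr_lt0.
  - by apply: powR_dominates; rewrite oppr_lt0 divr_gt0.
  - by apply: powR_dominates; rewrite ltrDl.
  - by apply: powR_dominates; rewrite oppr_lt0.
pose rh (n : nat) := Num.truncn (Num.sqrt (c n) / 2).
pose fix h (i : nat) := if i is m.+1 then (h m * rh (h m).*2)%N else N0.+1.
have hSE i : h i.+1 = (h i * rh (h i).*2)%N by [].
have h0E : h 0%N = N0.+1 by [].
clearbody h.
have cE n : c n = B * ln n%:R `^ beta by [].
have big_n n : (N0 <= n)%N -> [/\ 1 < ln n%:R :> R, 16 <= c n & (0 < n)%N].
  move=> /N0P[[t1 t16 _ _] _]; rewrite powRr0 mulr1 in t16; split => //.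
    by rewrite cE mulrC -ler_pdivrMr.
  by case: n t1 {t16} => // ; rewrite ln0 ?lexx// => /lt_trans/(_ ltr01); rewrite ltxx.
have rhP n : (N0 <= n)%N -> [/\ (2 <= rh n)%N,
    Num.sqrt (c n) / 4 <= (rh n)%:R & (rh n)%:R <= Num.sqrt (c n) / 2].
  move=> /big_n[_ c16 _]; have y4 : 4 <= Num.sqrt (c n).
    rewrite -[leLHS]ger0_norm// -sqrtr_sqr ler_wsqrtr//.
    by apply: le_trans c16; rewrite -natrX ler_nat.
  have /andP[r1 r2] : (rh n)%:R <= Num.sqrt (c n) / 2 < (rh n).+1%:R.
    by apply: truncn_itv; rewrite divr_ge0 ?sqrtr_ge0.
  rewrite -/(rh n) in r1 r2; rewrite -[(rh n).+1%:R]natr1 in r2; split => //; last by lra.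
  by rewrite -ltnS -(ltr_nat R) -[(rh n).+1%:R]natr1; lra.
have hN i : (N0 <= h i)%N /\ (N0 <= (h i).*2)%N.
  suff hi : (N0 <= h i)%N by rewrite hi -addnn (leq_trans hi)// leq_addl.
  elim: i => [|i IH]; first by rewrite h0E.
  rewrite hSE (leq_trans IH)// leq_pmulr//.
  have [|r2 _ _] := rhP (h i).*2; last exact: ltn_trans r2.
  by rewrite -addnn (leq_trans IH)// leq_addl.
pose t i : R := ln ((h i).*2)%:R.
have hP i := big_n _ (proj2 (hN i)).
have rP i := rhP _ (proj2 (hN i)).
have hpos i : (0 < h i)%N by have [_ _] := hP i; rewrite double_gt0.
have tS i : t i.+1 = t i + ln (rh (h i).*2)%:R.
  have [r2 _ _] := rP i.
  rewrite /t hSE -muln2 mulnAC muln2 natrM lnM ?posrE ?ltr0n ?double_gt0//.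
  exact: ltn_trans r2.
have c_mono n m : (N0 <= n)%N -> (n <= m)%N -> c n <= c m.
  move=> /big_n[t1 _ n0] nm; rewrite !cE ler_pM2l//; apply: powR_homo.
  - exact: ltW.
  - lra.
  - by rewrite ler_ln ?posrE ?ler_nat ?ltr0n// (leq_trans n0).
have f_anti n m : (N0 <= n)%N -> (n <= m)%N -> 0 <= f m <= f n.
  move=> /big_n[t1 _ n0] nm; rewrite /f /f_low mulr_ge0 ?powR_ge0 ?(ltW A0)//=.
  have lnm : ln n%:R <= ln m%:R :> R.
    by rewrite ler_ln ?posrE ?ler_nat ?ltr0n// (leq_trans n0).
  have t0 : 0 < ln n%:R :> R by lra.
  rewrite ler_pM2l// !powRN lef_pV2 ?posrE ?powR_gt0 ?(lt_le_trans t0)//.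
  by apply: powR_homo => //; exact: ltW.
have sqrtc i : Num.sqrt (c (h i).*2) = b * t i `^ (beta / 2).
  rewrite cE sqrtrM ?(ltW B0)//; congr (_ * _).
  by rewrite -powR12_sqrt ?powR_ge0// -powRrM.
have h_mono i : ((h i).*2 <= (h i.+1).*2)%N.
  by rewrite leq_double hSE leq_pmulr//; have [r2 _ _] := rP i; exact: ltn_trans r2.
apply: (@oscillating_sequence _ f c h (fun i => rh (h i).*2)
  (fun i => f (h i).*2) (fun i => Q * (t 0%N `^ (- sigma) - t i `^ (- sigma)))) => //.
- by move=> i; have [] := rP i.
- move=> i n /andP[hn nh]; split; first by apply: f_anti => //; have [] := hN i.+1.
  apply: le_trans (c_mono _ _ (proj2 (hN i.+1)) hn).
  have hp : 0 < (h i)%:R :> R by rewrite ltr0n.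
  have [_ _ r1] := rP i; have [_ _ r2] := rP i.+1; have [_ c16 _] := hP i.+1.
  have nle : n%:R / (h i)%:R <= 2 * ((rh (h i).*2)%:R * (rh (h i.+1).*2)%:R) :> R.
    rewrite ler_pdivrMr// -!natrM ler_nat (leq_trans (ltnW nh))//.
    have -> : (h i.+2).*2 = (2 * (rh (h i).*2 * rh (h i.+1).*2) * h i)%N.
      rewrite (hSE i.+1); set r := rh (h i.+1).*2; rewrite hSE -mul2n -!mulnA.
      by congr muln; rewrite mulnC -mulnA.
    exact: leqnn.
  have rr : (rh (h i).*2)%:R * (rh (h i.+1).*2)%:R <= c (h i.+1).*2 / 4.
    have -> : c (h i.+1).*2 / 4 = Num.sqrt (c (h i.+1).*2) / 2 * (Num.sqrt (c (h i.+1).*2) / 2).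
      rewrite mulrACA -expr2 sqr_sqrtr; last by apply: le_trans c16; rewrite ler0n.
      by congr (_ * _); field.
    have r1' : (rh (h i).*2)%:R <= Num.sqrt (c (h i.+1).*2) / 2.
      apply: (le_trans r1); rewrite ler_pM2r ?invr_gt0 ?ltr0n//; apply: ler_wsqrtr.
      exact: c_mono (proj2 (hN i)) (h_mono i).
    exact: ler_pM (ler0n _ _) (ler0n _ _) r1' r2.
  move: nle rr c16; set r := _%:R * _%:R; set cc := c _; set q := n%:R / _.
  by clear; move=> ? ? ?; lra.
- move=> i; have /andP[-> _] := f_anti _ _ (proj2 (hN i)) (leqnn _).
  have [[_ _ fle _] _] := N0P _ (proj2 (hN i)).
  by rewrite powRr0 in fle.
- move=> i; have [r2 _ r1] := rP i; have [t1 c16 _] := hP i.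
  have [[_ _ _ fle] [cle _]] := N0P _ (proj2 (hN i)).
  rewrite -/(t i) in t1 fle cle; rewrite powRr0 in fle; rewrite -cE in cle.
  have t0 : 0 < t i by lra.
  have rp : 0 < (rh (h i).*2)%:R :> R by rewrite ltr0n (ltn_trans _ r2).
  have rc : (rh (h i).*2)%:R <= c (h i).*2.
    rewrite (le_trans r1)//.
    have yy : c (h i).*2 = Num.sqrt (c (h i).*2) * Num.sqrt (c (h i).*2).
      by rewrite -expr2 sqr_sqrtr//; lra.
    have y1 : 1 <= Num.sqrt (c (h i).*2).
      by rewrite -(sqrtr1 R) ler_wsqrtr//; lra.
    rewrite [leRHS]yy ler_pM2l; lra.
  have lr : ln (rh (h i).*2)%:R <= (beta + 1) * (2 / alpha * t i `^ (alpha / 2)).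
    apply: (@le_trans _ _ ((beta + 1) * ln (t i))).
      rewrite -ln_powR ler_ln ?posrE ?powR_gt0//; exact: le_trans rc cle.
    rewrite ler_pM2l; last by lra.
    have := ln_le_sub1 (powR_gt0 (alpha / 2) t0); rewrite ln_powR => lt1.
    have a20 : 0 < alpha / 2 by lra.
    rewrite -(ler_pM2l a20).
    have -> : alpha / 2 * (2 / alpha * t i `^ (alpha / 2)) = t i `^ (alpha / 2).
      by field; rewrite gt_eqF.
    lra.
  have f0 : 0 < f (h i).*2 by rewrite mulr_gt0// powR_gt0.
  have := ler_wpM2l (ltW f0) lr.
  have -> : f (h i).*2 * ((beta + 1) * (2 / alpha * t i `^ (alpha / 2))) =
      A * (beta + 1) * (2 / alpha) * t i `^ (- (alpha / 2)).
    have -> : t i `^ (- (alpha / 2)) = t i `^ (- alpha) * t i `^ (alpha / 2).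
      rewrite -powRD; last by rewrite (gt_eqF t0) implybT.
      by congr (_ `^ _); field.
    by rewrite /f /f_low -/(t i); ring.
  lra.
- by rewrite subrr mulr0.
- move=> i; have [_ [_ Qle]] := N0P _ (proj2 (hN 0%N)).
  rewrite powRr0 -/(t 0%N) in Qle.
  have : 0 <= Q * t i `^ (- sigma) by rewrite mulr_ge0// powR_ge0.
  rewrite mulrBr; lra.
- move=> i; have [r2 r1 _] := rP i; have [t1 _ _] := hP i.
  rewrite -/(t i) in t1; have t0 : 0 < t i by lra.
  have rp : 0 < (rh (h i).*2)%:R :> R by rewrite ltr0n (ltn_trans _ r2).
  have tt : t i + 2^-1 <= t i.+1.
    rewrite tS lerD2l; apply: (@le_trans _ _ (ln 2)).
      have := @ln_le_sub1 R 2^-1; rewrite lnV ?posrE// invr_gt0 => /(_ (ltr0n _ _)).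
      lra.
    by rewrite ler_ln ?posrE// ler_nat.
  have := ler_wpM2l Q0 (powR_decrement_ge s0 (ltW t1) tt).
  suff : 4 * f (h i).*2 / (rh (h i).*2)%:R <=
      Q * (sigma / 2 * (2 * t i) `^ (- (sigma + 1))) by rewrite !mulrBr; lra.
  have y0 : 0 < Num.sqrt (c (h i).*2) by rewrite sqrtc mulr_gt0// powR_gt0.
  apply: (@le_trans _ _ (16 * f (h i).*2 / Num.sqrt (c (h i).*2))).
    rewrite ler_pdivrMr// mulrAC ler_pdivlMr//.
    have f0 : 0 < f (h i).*2 by rewrite mulr_gt0// powR_gt0.
    have := ler_wpM2l (ltW f0) r1; lra.
  rewrite le_eqVlt; apply/orP; left; apply/eqP.
  have sE : sigma + 1 = alpha + beta / 2 by rewrite /sigma subrK.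
  have ta : 0 < t i `^ alpha by exact: powR_gt0.
  have tb : 0 < t i `^ (beta / 2) by exact: powR_gt0.
  have tsE : t i `^ (sigma + 1) = t i `^ alpha * t i `^ (beta / 2).
    by rewrite sE powRD// (gt_eqF t0) implybT.
  have p2 : 0 < 2 `^ (sigma + 1) :> R by exact: powR_gt0.
  rewrite sqrtc /f /f_low -/(t i) powRM ?(ltW t0)// /Q !powRN.
  rewrite tsE.
  by field; rewrite !gt_eqF.
Unshelve. all: by end_near. Qed.

Theorem theorem1 (R : realType) (d : nat) (hd : (1 <= d)%N)
    (A B alpha beta : R) (hA : 0 < A) (hB : 0 < B)
    (halpha : 0 < alpha) (hbeta : 0 < beta) :
  (alpha + beta / 2 <= 1 ->
     forall (k : nat) (p : nat -> nat -> R) (a : nat -> 'rV[R]_d),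
       (2 <= k)%N ->
       admissible (f_low A alpha) (c_up B beta) k p ->
       averaging_sequence k p a ->
       cvg (a n @[n --> \oo]))
  /\
  (1 < alpha + beta / 2 ->
     exists (k : nat) (p : nat -> nat -> R) (a : nat -> 'rV[R]_d),
       [/\ (2 <= k)%N,
           admissible (f_low A alpha) (c_up B beta) k p,
           averaging_sequence k p a &
           ~ cvg (a n @[n --> \oo])]).
Proof.
split=> [ab k p a _ adm avg|ab].
  apply: rV_seq_cvg => i.
  exact: scalar_averaging_cvg ab adm (averaging_coord i avg).
have [k [p [x [k2 adm avg xdiv]]]] := scalar_oscillation hA hB halpha hbeta ab.
exists k, p, (fun n => const_mx (x n)); split => //.
  move=> n kn; apply/matrixP => i j; rewrite summxE mxE avg//.
  by apply: eq_bigr => l _; rewrite !mxE.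
move=> acvg; apply: xdiv; have := acvg.
case: d hd {acvg} => // d' _ /cvg_ex[l al].
apply/cvg_ex; exists (l 0 0).
have coordE : (fun n => (const_mx (x n) : 'rV[R]_d'.+1) 0 0) = x.
  by apply/funext => n; rewrite mxE.
have coordC := @coord_continuous R 1 d'.+1 0 0 l.
rewrite -coordE; exact: (cvg_comp _ _ al coordC).
Qed.
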